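(* Let $\Omega$ be a discrete filtered set. There exists an $\Omega$-endless Riemann surface $(X_\Omega,\mathfrak{p}_\Omega,\underline{0}_\Omega)$ such that for any $\Omega$-endless Riemann surface $(X,\mathfrak{p},\underline{0})$ there is a unique morphism $\mathfrak{q}:(X_\Omega,\mathfrak{p}_\Omega,\underline{0}_\Omega)\to(X,\mathfrak{p},\underline{0})$. The $\Omega$-endless Riemann surface $(X_\Omega,\mathfrak{p}_\Omega,\underline{0}_\Omega)$ is unique up to isomorphism, and $X_\Omega$ is simply connected.
   Context: A discrete filtered set (d.f.s.) is a family $\Omega=(\Omega_L)_{L\ge0}$ of finite subsets of $\mathbb{C}$ with $\Omega_{L_1}\subseteq\Omega_{L_2}$ for $L_1\le L_2$ and $\Omega_\delta=\emptyset$ for some $\delta>0$. Let $\mathcal{S}_\Omega=\{(\lambda,\omega)\in\mathbb{R}\times\mathbb{C}\mid\lambda\ge0,\ \omega\in\Omega_\lambda\}$ and $\mathcal{M}_\Omega=(\mathbb{R}\times\mathbb{C})\setminus\overline{\mathcal{S}_\Omega}$. A Lipschitz path $\gamma:[0,1]\to\mathbb{C}$ with $\gamma(0)=0$ is $\Omega$-allowed if $(L(\gamma_{|t}),\gamma(t))\in\mathcal{M}_\Omega$ for all $t$, where $\gamma_{|t}$ is the restriction to $[0,t]$ and $L(\cdot)$ is length. An $\Omega$-endless Riemann surface is a triple $(X,\mathfrak{p},\underline{0})$ where $X$ is a connected Riemann surface, $\mathfrak{p}:X\to\mathbb{C}$ is a local biholomorphism, $\underline{0}\in\mathfrak{p}^{-1}(0)$,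 and every $\Omega$-allowed path $\gamma:[0,1]\to\mathbb{C}$ has a lift $\underline{\gamma}:[0,1]\to X$ (i.e. $\mathfrak{p}\circ\underline\gamma=\gamma$) with $\underline{\gamma}(0)=\underline{0}$. A morphism $(X,\mathfrak{p},\underline{0})\to(X',\mathfrak{p}',\underline{0}')$ of $\Omega$-endless Riemann surfaces is a local biholomorphism $\mathfrak{q}:X\to X'$ with $\mathfrak{p}'\circ\mathfrak{q}=\mathfrak{p}$ and $\mathfrak{q}(\underline{0})=\underline{0}'$. *)

(* Defs.v *)
From HB Require Import structures.
From mathcomp Require Import all_boot all_order all_algebra.
From mathcomp Require Import all_classical all_reals all_analysis.
Set Implicit Arguments. Unset Strict Implicit. Unset Printing Implicit Defensive.
Import Order.TTheory GRing.Theory Num.Theory.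
Local Open Scope classical_set_scope.
Local Open Scope ring_scope.
Import numFieldNormedType.Exports.

Section Defs.
Context {R : realType}.

(* The complex plane, as R x R with its (product = Euclidean) topology. *)
Local Notation C := (R * R)%type.
Definition C0 : C := (0, 0).
Definition distC (z w : C) : R :=
  Num.sqrt ((z.1 - w.1) ^+ 2 + (z.2 - w.2) ^+ 2).

Definition I01 : set R := [set t | 0 <= t <= 1].

Definition is_dfs (Om : R -> set C) : Prop :=
  (forall L, 0 <= L -> finite_set (Om L)) /\
  (forall L1 L2, 0 <= L1 -> L1 <= L2 -> Om L1 `<=` Om L2) /\
  (exists delta, 0 < delta /\ Om delta = set0).

Definition S_Om (Om : R -> set C) : set (R * C) :=
  [set lw | 0 <= lw.1 /\ Om lw.1 lw.2].
Definition M_Om (Om : R -> set C) : set (R * C) := ~` @closure (R * (R * R))%type (S_Om Om).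

Definition lipschitz01 (g : R -> C) : Prop :=
  exists k : R, forall s t, I01 s -> I01 t -> distC (g s) (g t) <= k * `|s - t|.

Definition partition0 (t : R) (s : seq R) : Prop :=
  sorted <=%R s /\ head 0 s = 0 /\ last 0 s = t.
Definition var_sum (g : R -> C) (s : seq R) : R :=
  \sum_(i < (size s).-1) distC (g (nth 0 s i.+1)) (g (nth 0 s i)).
Definition path_length (g : R -> C) (t : R) : R :=
  sup [set var_sum g s | s in partition0 t].

Definition allowed (Om : R -> set C) (g : R -> C) : Prop :=
  lipschitz01 g /\ g 0 = C0 /\
  forall t, I01 t -> M_Om Om (path_length g t, g t).

(* Local homeomorphism (continuity is asked separately). *)
Definition local_homeo {X Y : topologicalType} (f : X -> Y) : Prop :=
  forall x, exists U : set X, [/\ open U, U x, {in U &, injective f} &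
    forall V, open V -> V `<=` U -> open (f @` V)].

(* A Riemann surface X together with a local biholomorphism p : X -> C is the
   same as a connected Hausdorff space X with a local homeomorphism p : X -> C
   (the complex structure being the pull-back by p). *)
Definition spread_surface (X : topologicalType) (p : X -> C) : Prop :=
  [/\ hausdorff_space X, connected [set: X], continuous p & local_homeo p].

Definition endless (Om : R -> set C) (X : topologicalType) (p : X -> C) (o : X)
  : Prop :=
  [/\ spread_surface p, p o = C0 &
    forall g : R -> C, allowed Om g ->
      exists lg : R -> X, [/\ {within I01, continuous lg},
        (forall t, I01 t -> p (lg t) = g t) & lg 0 = o]].

(* Morphisms: local biholomorphisms q with p' \o q = p, q o = o'.  With the
   pulled-back complex structures these are the continuous local homeomorphisms
   commuting with the projections. *)
Definition endless_morphism (X : topologicalType) (p : X -> C) (o : X)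
  (X' : topologicalType) (p' : X' -> C) (o' : X') (q : X -> X') : Prop :=
  [/\ continuous q, local_homeo q, (forall x, p' (q x) = p x) & q o = o'].

Definition universal_endless (Om : R -> set C) (X0 : topologicalType)
  (p0 : X0 -> C) (o0 : X0) : Prop :=
  forall (X : topologicalType) (p : X -> C) (o : X), endless Om p o ->
    exists q : X0 -> X, endless_morphism p0 o0 p o q /\
      forall q', endless_morphism p0 o0 p o q' -> forall x, q' x = q x.

Definition endless_iso (X : topologicalType) (p : X -> C) (o : X)
  (X' : topologicalType) (p' : X' -> C) (o' : X') : Prop :=
  exists (q : X -> X') (r : X' -> X),
    [/\ endless_morphism p o p' o' q, endless_morphism p' o' p o r,
        (forall x, r (q x) = x) & (forall y, q (r y) = y)].

Definition simply_connected (X : topologicalType) : Prop :=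
  (forall x y : X, exists g : R -> X,
      [/\ {within I01, continuous g}, g 0 = x & g 1 = y]) /\
  (forall g : R -> X, {within I01, continuous g} -> g 0 = g 1 ->
     exists H : R * R -> X, [/\ {within I01 `*` I01, continuous H},
       (forall s, I01 s -> H (s, 0) = g s),
       (forall s, I01 s -> H (s, 1) = g 0) &
       (forall u, I01 u -> H (0, u) = g 0 /\ H (1, u) = g 0)]).

End Defs.

(* Main.v *)
(** The surface [X_Om] is the set of allowed paths, two of them being identified
    when, in every endless surface, their lifts end at the same point. An
    allowed path can be prolonged by a short segment in any direction; these
    prolongations are the sheets that topologize [X_Om], and unique lifting in
    the other surfaces makes them compatible, hence [X_Om] Hausdorff. Taking the
    end of the lift maps [X_Om] to any endless surface, and initiality follows.

    Simple connectedness comes from initiality: for [b] in [X_Om] the homotopy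
    classes of paths issued from [b] form again an endless surface (the
    universal cover), so the initial morphism [q] is a section of it. If
    [q b = [c]] and [g] is a loop at [b], unique lifting along [g] gives
    [[c g] = [c]], so [g] is null-homotopic.

    Paths are continuous on all of [R], frozen outside of [0, 1] by [clamp]. *)

Require Import Defs.
From HB Require Import structures.
From mathcomp Require Import all_boot all_order all_algebra.
From mathcomp Require Import all_classical all_reals all_analysis.
From mathcomp Require Import ring lra.
Set Implicit Arguments. Unset Strict Implicit. Unset Printing Implicit Defensive.
Import Order.TTheory GRing.Theory Num.Theory.
Import numFieldNormedType.Exports.
Local Open Scope classical_set_scope.
Local Open Scope ring_scope.

(** The familiar construction takes allowed paths up to homotopy through allowed paths. The relation
    [same_lift] keeps only what endless surfaces can see: initiality becomes nearly immediate and no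
    homotopy of allowed paths has to be built. The price is that simple connectedness is not visible
    in the construction, hence the detour through the universal cover. All that is used of the path
    [c] there is that it ends at [b], which is what being a section gives. Both surfaces are
    instances of one datum, [sheets], whose crux is rigidity: two local sections that agree at one
    common point agree on the whole overlap of their balls. Both times it comes from unique lifting
    along a segment, the overlap of two balls being convex. Lengths are suprema and are never
    computed: since the allowed region is closed under decreasing the length, any upper bound of the
    length will do. *)

(** * Preliminaries on continuity, connectedness and convexity *)

Lemma continuous_atP (T U : topologicalType) (f : T -> U) (x : T) :
  (forall V, nbhs (f x) V -> nbhs x (f @^-1` V)) -> {for x, continuous f}.
Proof. by []. Qed.

Lemma continuous_pair (S T U : topologicalType) (f : S -> T) (g : S -> U)
    (x : S) :
  {for x, continuous f} -> {for x, continuous g} ->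
  {for x, continuous (fun y => (f y, g y))}.
Proof. by move=> cf cg; exact: (cvg_pair cf cg). Qed.

Lemma continuous_near_eq (T U : topologicalType) (f g : T -> U) (x : T) :
  (\forall y \near x, f y = g y) -> {for x, continuous g} ->
  {for x, continuous f}.
Proof.
move=> fg cg; apply: continuous_atP => V; rewrite (nbhs_singleton fg) => nV.
have ng : nbhs x (g @^-1` V) := cg V nV.
by apply: filterS2 fg ng => y; rewrite /preimage /= => ->.
Qed.

(** The local condition is symmetric in [s1] and [s2]: carrying [P] away from the centre of [W]
    shows that [P] is open, carrying it back to the centre that its complement is. *)
Lemma connected_ind (T : topologicalType) (P : T -> Prop) (t0 : T) :
  connected [set: T] -> P t0 ->
  (forall t : T, exists2 W : set T, nbhs t W &
     forall s1 s2, W s1 -> W s2 -> P s1 -> P s2) ->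
  forall t, P t.
Proof.
move=> cT Pt0 loc t.
have : [set x | P x] = setT.
  apply: cT; first by exists t0.
  - exists [set x | P x]; last by rewrite setTI.
    rewrite openE => x /= Px; have [W nW HW] := loc x.
    apply: (filterS _ nW) => y Wy; apply: (HW x) => //.
    exact: nbhs_singleton (nW).
  - exists [set x | P x]; last by rewrite setTI.
    rewrite -openC openE => x /= nPx; have [W nW HW] := loc x.
    apply: (filterS _ nW) => y Wy Py; apply: nPx; apply: (HW y) => //.
    exact: nbhs_singleton (nW).
by move=> e; have : [set: T] t by []; rewrite -e.
Qed.

Lemma connectedRT (R : realType) : connected [set: R].
Proof. by apply/connected_intervalP => x y _ _ z _. Qed.

Lemma connected_setT_by_paths (R : realType) (T : topologicalType) (o : T) :
  (forall x : T, exists g : R -> T, [/\ continuous g, g 0 = o & g 1 = x]) ->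
  connected [set: T].
Proof.
move=> H.
have -> : [set: T] = \bigcup_(g in [set g : R -> T | continuous g /\ g 0 = o])
    (g @` [set: R]).
  rewrite eqEsubset; split=> [x _|//].
  by have [g [cg g0 g1]] := H x; exists g => //; exists 1.
apply: bigcup_connected.
  by exists o => g [_ g0]; exists 0.
move=> g [cg _]; apply: connected_continuous_connected.
  exact: connectedRT.
exact: continuous_subspaceT.
Qed.

Lemma continuous_paste (R : realType) (T U : topologicalType) (h : T -> R)
    (f g : T -> U) :
  continuous h -> continuous f -> continuous g ->
  (forall x, h x = 0 -> f x = g x) ->
  continuous (fun x => if h x <= 0 then f x else g x).
Proof.
move=> ch cf cg fg x.
have [hx|hx|hx] := ltgtP (h x) 0.
- rewrite /continuous_at ltW //.
  apply: cvg_trans (cf x); apply: near_eq_cvg.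
  have : \forall y \near x, h y < 0 by exact: (ch x _ (lt_nbhsl hx)).
  by apply: filterS => y hy; rewrite ltW.
- rewrite /continuous_at [h x <= 0]lt_geF //.
  apply: cvg_trans (cg x); apply: near_eq_cvg.
  have : \forall y \near x, 0 < h y by exact: (ch x _ (lt_nbhsr hx)).
  by apply: filterS => y hy; rewrite lt_geF.
- rewrite /continuous_at hx lexx => V nV.
  have nf : nbhs x (f @^-1` V) := cf x V nV; have ng : nbhs x (g @^-1` V).
    by apply: cg; rewrite -fg.
  have : nbhs x (fun y => V (if h y <= 0 then f y else g y)); last by [].
  by apply: filterS (filterI nf ng) => y [Vf Vg]; case: (h y <= 0).
Qed.

Lemma conv_gt0 (R : realType) (v a b : R) : I01 v -> 0 < a -> 0 < b ->
  0 < (1 - v) * a + v * b.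
Proof.
move=> /andP[v0 v1] a0 b0; move: v0; rewrite le_eqVlt => /predU1P[<-|v0].
  by rewrite subr0 mul1r mul0r addr0.
by rewrite ltr_wpDl // ?mulr_gt0 // mulr_ge0 // ?subr_ge0 // ltW.
Qed.

(** Stated on the line because balls of the plane are products of intervals, so that convexity is
    checked one coordinate at a time. *)
Lemma ball_convR (R : realType) (x e y z v : R) : I01 v ->
  ball x e y -> ball x e z -> ball x e (y + v * (z - y)).
Proof.
move=> Iv; rewrite -!ball_normE /= !ltr_norml => /andP[a1 a2] /andP[b1 b2].
have := @conv_gt0 _ v (e + (x - y)) (e + (x - z)) Iv.
have := @conv_gt0 _ v (e - (x - y)) (e - (x - z)) Iv.
move=> h1 h2; apply/andP; split.
  have : 0 < (1 - v) * (e + (x - y)) + v * (e + (x - z)) by apply: h2; lra.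
  by move=> h; nra.
have : 0 < (1 - v) * (e - (x - y)) + v * (e - (x - z)) by apply: h1; lra.
by move=> h; nra.
Qed.

(** * Paths extended from the unit interval to the line *)

Section Clamp.
Context {R : realType}.
Implicit Types t : R.

Definition clamp t : R := Num.max 0 (Num.min t 1).

Lemma clamp_I01 t : I01 (clamp t).
Proof. by rewrite /I01 /clamp /= le_max lexx /= ge_max ler01 ge_min lexx orbT. Qed.

Lemma clamp_id t : I01 t -> clamp t = t.
Proof. by move=> /andP[t0 t1]; rewrite /clamp min_l // max_r. Qed.

Lemma clamp0 : clamp 0 = 0.
Proof. by rewrite clamp_id // /I01 /= lexx ler01. Qed.

Lemma clamp1 : clamp 1 = 1.
Proof. by rewrite clamp_id // /I01 /= lexx ler01. Qed.

Lemma clamp_continuous : continuous clamp.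
Proof.
move=> t; apply: (@continuous_max R R (cst 0) (fun t => Num.min t 1) t); first exact: cvg_cst.
by apply: (@continuous_min R R id (cst 1) t); [exact: cvg_id|exact: cvg_cst].
Qed.

Lemma continuous_clamp (X : topologicalType) (g : R -> X) :
  {within I01, continuous g} -> continuous (fun t => g (clamp t)).
Proof.
move=> /subspace_continuousP cg t V /= nV.
have /= := cg (clamp t) (clamp_I01 t) V nV.
rewrite /within /= => nW.
have nC : nbhs t (clamp @^-1` _) := clamp_continuous nW.
have : nbhs t (fun s => V (g (clamp s))); last by [].
by apply: filterS nC => s; apply; exact: clamp_I01.
Qed.

End Clamp.

(** * Unique lifting, local sections and families of lifts *)

Section Spread.
Context {R : realType} {X : topologicalType} (p : X -> (R * R)%type).
Hypotheses (hX : hausdorff_space X) (cp : continuous p) (lp : local_homeo p).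

(** The set of agreement is open by local injectivity of [p], and its complement is open because [X]
    is Hausdorff. *)
Lemma lift_unique (T : topologicalType) (f g : T -> X) (t0 : T) :
  connected [set: T] -> continuous f -> continuous g ->
  (forall t, p (f t) = p (g t)) -> f t0 = g t0 -> forall t, f t = g t.
Proof.
move=> cT cf cg pfg fg0; apply: (connected_ind (t0 := t0)) => // t.
have [eq|/eqP neq] := pselect (f t = g t).
  have [U [oU Uf injU _]] := lp (f t).
  exists (f @^-1` U `&` g @^-1` U).
    by apply: filterI; [apply: cf|apply: cg; rewrite -eq]; exact: open_nbhs_nbhs.
  move=> s1 s2 _ [Uf2 Ug2] _; apply: injU => //; rewrite ?inE //.
move: hX; rewrite open_hausdorff => /(_ _ _ neq)[[A B] /= [Af Bg] [oA oB AB]].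
exists (f @^-1` A `&` g @^-1` B).
  apply: filterI; [apply: cf|apply: cg]; apply: open_nbhs_nbhs; split => //;
    exact: set_mem.
move=> s1 s2 [/= A1 B1] _ eq1; exfalso.
have ABs : (A `&` B) (f s1) by split => //=; rewrite eq1.
by move: ABs; rewrite (eqP AB).
Qed.

(** Radius and section are packed in one pair so that a single choice can extract both. The last
    clause says that the section fills a neighbourhood of [x], not only that it passes through
    [x]. *)
Lemma local_section (x : X) : exists rs : R * (R * R -> X),
  [/\ 0 < rs.1, rs.2 (p x) = x, forall z, ball (p x) rs.1 z -> p (rs.2 z) = z,
      forall z, ball (p x) rs.1 z -> {for z, continuous rs.2} &
      \forall y \near x, ball (p x) rs.1 (p y) /\ y = rs.2 (p y)].
Proof.
have [U [oU Ux injU opU]] := lp x.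
have op : nbhs (p x) (p @` U).
  by apply: open_nbhs_nbhs; split; [exact: opU|exists x].
have /nbhs_ballP[r /= r0 rU] := op.
have /choice[s Hs] : forall z, exists y, (p @` U) z -> U y /\ p y = z.
  move=> z; have [[y Uy yz]|n] := pselect ((p @` U) z); first by exists y.
  by exists x.
exists (r, s); split => //=.
- have [Us ps] := Hs (p x) (rU _ (ballxx _ r0)).
  by apply: injU; rewrite ?inE.
- by move=> z /rU /Hs[].
- move=> z /rU Uz V /= nV.
  have [Us ps] := Hs z Uz.
  move: nV; rewrite nbhsE => -[V' [oV' V's] V'V].
  have : nbhs z (p @` (V' `&` U)).
    apply: open_nbhs_nbhs; split; first by apply: opU => //; exact: openI.
    by exists (s z).
  apply: filterS => w [y [V'y Uy] <-]; apply: V'V.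
  have [] := Hs (p y); first by exists y.
  by move=> Us' ps'; rewrite (injU (s (p y)) y) ?inE.
- have nb : nbhs x (p @^-1` (ball (p x) r)) by apply: cp; exact: nbhsx_ballx.
  have nU : nbhs x U by exact: open_nbhs_nbhs.
  apply: filterS2 nb nU => y /= bpy Uy; split => //.
  by have [Us ps] := Hs _ (rU _ bpy); apply: injU; rewrite ?inE.
Qed.

(* The lifts near [a0] are pushed along the parameter line: over a small window
   of the line every nearby lift must stay in the same sheet. *)
Lemma lift_family_continuous (A : topologicalType) (a0 : A) (x0 : X)
    (f : A -> R -> X) (F : A * R -> (R * R)%type) :
  continuous F ->
  (\forall a \near a0, [/\ continuous (f a), f a 0 = x0 &
      forall t, p (f a t) = F (a, t)]) ->
  forall t, {for a0, continuous (f^~ t)}.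
Proof.
move=> cF nf.
have cF1 u a : (fun b => F (b, u)) @ a --> F (a, u).
  apply: (@continuous_comp _ _ _ (fun b => (b, u)) F); last exact: cF.
  by apply: continuous_pair; [exact: cvg_id|exact: cvg_cst].
have [cf0 f00 pf0] := nbhs_singleton nf.
apply: (connected_ind (t0 := 0)); first exact: connectedRT.
  (* At time 0 all nearby lifts sit at [x0]. *)
  apply: continuous_atP => V; rewrite f00 => nV.
  by apply: filterS nf => a [_ fa0 _]; rewrite /preimage /= fa0; exact: nbhs_singleton.
move=> t; have [[r s] /= [r0 sp ps cs ns]] := local_section (f a0 t).
have nF : nbhs (a0, t) (F @^-1` (ball (p (f a0 t)) r)).
  by apply: cF; rewrite pf0; exact: nbhsx_ballx.
have [/= [N W0] /= [nN nW0] NW0] := nF.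
have NW a u : N a -> W0 u -> ball (p (f a0 t)) r (F (a, u)).
  by move=> Na Wu; exact: (NW0 (a, u)).
have nW1 : nbhs t (f a0 @^-1` (fun y => ball (p (f a0 t)) r (p y) /\ y = s (p y))).
  exact: cf0.
have /nbhs_ballP[e /= e0 eW] : nbhs t
    (W0 `&` f a0 @^-1` (fun y => ball (p (f a0 t)) r (p y) /\ y = s (p y))).
  exact: filterI.
exists (ball t e); first exact: nbhsx_ballx.
move=> s1 s2 b1 b2 c1.
have [W1 [b1s e1]] := eW _ b1.
(* Continuity at [s1] keeps the lifts inside an injectivity domain of [p], which pins them to the
   section [s]. *)
have nV : \forall a \near a0, f a s1 = s (F (a, s1)).
  have [U [oU Ux injU opU]] := lp (f a0 s1).
  have nU : nbhs a0 ((f^~ s1) @^-1` U) by apply: c1; exact: open_nbhs_nbhs.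
  have nUs : nbhs a0 (fun a => U (s (F (a, s1)))).
    have nU1 : nbhs (F (a0, s1)) (s @^-1` U).
      by apply: cs; rewrite -pf0 // -e1; exact: open_nbhs_nbhs.
    exact: cF1 nU1.
  apply: filterS (filterI (filterI nU nUs) (filterI nf nN)).
  move=> a [[Ua Usa] [[_ _ pfa] Na]].
  by apply: injU; rewrite ?inE // pfa ps //; exact: NW.
(* The path [h] goes from [s1] to [s2] inside the window; along it, [f a] and the section are two
   lifts of the same curve that agree at the start. *)
pose h (u : R) := s1 + clamp u * (s2 - s1).
have ch : continuous h.
  move=> u; apply: cvgD; first exact: cvg_cst.
  by apply: cvgM; [exact: clamp_continuous|exact: cvg_cst].
have bh u : ball t e (h u) by apply: ball_convR => //; exact: clamp_I01.
have nV2 : \forall a \near a0, f a s2 = s (F (a, s2)).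
  near=> a; have [cfa fa0 pfa] : [/\ continuous (f a), f a 0 = x0 &
      forall t, p (f a t) = F (a, t)] by near: a; exact: nf.
  have Na : N a by near: a; exact: nN.
  have bF u : ball (p (f a0 t)) r (F (a, h u)).
    by apply: NW => //; have [] := eW _ (bh u).
  have h0 : h 0 = s1 by rewrite /h clamp0 mul0r addr0.
  have h1 : h 1 = s2 by rewrite /h clamp1 mul1r addrC subrK.
  rewrite -h1; apply: (@lift_unique R (f a \o h) (fun u => s (F (a, h u))) 0).
  - exact: connectedRT.
  - by move=> u; apply: continuous_comp; [exact: ch|exact: cfa].
  - move=> u; apply: (@continuous_comp _ _ _ (fun u => F (a, h u)) s); last exact: cs.
    apply: (@continuous_comp _ _ _ (fun u => (a, h u)) F); last exact: cF.
    by apply: continuous_pair; [exact: cvg_cst|exact: ch].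
  - by move=> u; rewrite ps //= pfa.
  - by rewrite /= h0; near: a; exact: nV.
apply: (continuous_near_eq nV2).
apply: (@continuous_comp _ _ _ (fun a => F (a, s2)) s); first exact: cF1.
by apply: cs; apply: NW => //; [exact: nbhs_singleton|have [] := eW _ b2].
Unshelve. all: by end_near. Qed.

End Spread.

(** A morphism is thus any continuous map over the plane that respects base points. Inside an
    injectivity domain [U'] of [p'], the image [q @]
    V[is cut out by the open condition that]p'[falls in]p @[V]. *)
Lemma morphism_local_homeo (R : realType) (X X' : topologicalType)
    (p : X -> (R * R)%type) (p' : X' -> (R * R)%type) (q : X -> X') :
  local_homeo p -> local_homeo p' -> continuous p' -> continuous q ->
  (forall x, p' (q x) = p x) -> local_homeo q.
Proof.
move=> lp lp' cp' cq pq x.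
have [U [oU Ux injU opU]] := lp x.
have [U' [oU' Ux' injU' opU']] := lp' (q x).
have oq : open (q @^-1` U') by apply: open_comp.
exists (U `&` q @^-1` U'); split => //; first exact: openI.
  move=> y z; rewrite !inE => -[Uy _] [Uz _] e.
  by apply: injU; rewrite ?inE // -!pq e.
move=> V oV VU.
have -> : q @` V = U' `&` p' @^-1` (p @` V).
  rewrite eqEsubset; split=> [_ [v Vv <-]|y [U'y [v Vv pv]]].
    split; first by have [] := VU _ Vv.
    by exists v.
  exists v => //; apply: injU'; rewrite ?inE //; last by rewrite pq.
  by have [] := VU _ Vv.
apply: openI => //; apply: open_comp => //; apply: opU => //.
by move=> v /VU[].
Qed.

(** * Spaces glued from sheets *)

Section Subquotient.
Context {P : Type} (valid : P -> Prop) (E : P -> P -> Prop).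

(** The relations to be divided out are equivalences only among valid elements, so a class is a set
    of valid elements. *)
Definition is_class (A : set P) :=
  exists2 c, valid c & A = [set c' | valid c' /\ E c c'].
Definition subquot : Type := {A : set P | is_class A}.

Lemma subquot_inj (x y : subquot) : sval x = sval y -> x = y.
Proof. by case: x y => [A cA] [B cB] /= AB; exact: eq_exist. Qed.

Context (b : P) (vb : valid b).

(** Made total by sending invalid elements to the class of [b], so that terms carry no proof of
    validity. *)
Definition cls (c : P) : subquot :=
  match pselect (valid c) with
  | left vc => exist is_class _ (ex_intro2 _ _ c vc erefl)
  | right _ => exist is_class _ (ex_intro2 _ _ b vb erefl)
  end.
Definition rep (x : subquot) : P := projT1 (cid2 (projT2 x)).

Lemma rep_valid x : valid (rep x).
Proof. by rewrite /rep; case: cid2. Qed.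

Lemma cls_rep x : cls (rep x) = x.
Proof.
rewrite /cls; case: pselect => [vc|]; last by case; exact: rep_valid.
apply: subquot_inj => /=; rewrite {vc} /rep; case: cid2 => c vc /= ->.
by [].
Qed.

Hypothesis E_refl : forall c, valid c -> E c c.
Hypothesis E_sym : forall c d, valid c -> valid d -> E c d -> E d c.
Hypothesis E_trans : forall c d e, valid c -> valid d -> valid e ->
  E c d -> E d e -> E c e.

Lemma cls_eqP c d : valid c -> valid d -> cls c = cls d <-> E c d.
Proof.
move=> vc vd; rewrite /cls; case: pselect => // vc'; case: pselect => // vd'.
split=> [/(congr1 sval) /= e|Ecd].
  have : [set c' | valid c' /\ E d c'] d by split => //; exact: E_refl.
  by rewrite -e => -[].
apply: subquot_inj => /=; apply/seteqP; split=> x [vx Ex]; split => //.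
  by apply: (E_trans vd vc vx) => //; exact: E_sym.
exact: (E_trans vc vd vx).
Qed.

End Subquotient.

(* [ssec x] is the local section of the projection through [x], meaningful only
   on the ball of radius [srad x]. *)
Record sheets (R : realType) := Sheets {
  scar : Type;
  sproj : scar -> (R * R)%type;
  srad : scar -> R;
  ssec : scar -> (R * R)%type -> scar;
  srad_gt0 : forall x, 0 < srad x;
  sproj_sec : forall x z, ball (sproj x) (srad x) z -> sproj (ssec x z) = z;
  ssec_proj : forall x, ssec x (sproj x) = x;
  ssec_compat : forall x y z w,
    ball (sproj x) (srad x) z -> ball (sproj y) (srad y) z ->
    ball (sproj x) (srad x) w -> ball (sproj y) (srad y) w ->
    ssec x z = ssec y z -> ssec x w = ssec y w }.

Definition sheet_space (R : realType) (D : sheets R) : Type := scar D.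

Section SheetTopology.
Context {R : realType} (D : sheets R).
Local Notation T := (sheet_space D).

HB.instance Definition _ := gen_eqMixin T.
HB.instance Definition _ := gen_choiceMixin T.

Definition sheet_open : set_system T :=
  [set U | forall x, U x -> nbhs (sproj x) (fun z => U (ssec x z))].

Let sheet_openT : sheet_open setT.
Proof. by move=> x _; exact: filterT. Qed.

Let sheet_openI : setI_closed sheet_open.
Proof. by move=> A B oA oB x [Ax Bx]; apply: filterI; [exact: oA|exact: oB]. Qed.

Let sheet_open_bigU (I : Type) (f : I -> set T) :
  (forall i, sheet_open (f i)) -> sheet_open (\bigcup_i f i).
Proof.
by move=> of_ x [i _ fx]; apply: filterS (of_ i x fx) => z fz; exists i.
Qed.

HB.instance Definition _ :=
  isOpenTopological.Build T sheet_openT sheet_openI sheet_open_bigU.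

End SheetTopology.

Section SheetTheory.
Context {R : realType} (D : sheets R).
Local Notation T := (sheet_space D).
Local Notation pr := (@sproj R D : T -> (R * R)%type).
Local Notation sec := (@ssec R D : T -> (R * R)%type -> T).

Let near_ball (x : T) z : ball (pr x) (srad x) z ->
  \forall w \near z, ball (pr x) (srad x) w.
Proof.
move=> bz; apply: open_nbhs_nbhs; split => //.
exact: (@ball_open R (R * R)%type).
Qed.

(** Recentring a sheet does not change it: both sections take the value [sec x z] at [z], and
    rigidity does the rest. *)
Lemma ssec_ssec (x : T) z w : ball (pr x) (srad x) z ->
  ball (pr x) (srad x) w -> ball z (srad (sec x z)) w ->
  sec (sec x z) w = sec x w.
Proof.
move=> bz bw bw'.
have pz : pr (sec x z) = z := sproj_sec bz.
apply: (@ssec_compat _ D (sec x z) x z w) => //.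
- by rewrite [sproj _]pz; apply: ballxx; exact: srad_gt0.
- by rewrite [sproj _]pz.
- by rewrite -{2}pz ssec_proj.
Qed.

Lemma near_ssec_ssec (x : T) z : ball (pr x) (srad x) z ->
  \forall w \near z, sec (sec x z) w = sec x w.
Proof.
move=> bz; near=> w; apply: ssec_ssec => //; near: w; first exact: near_ball.
by apply: nbhsx_ballx; exact: srad_gt0.
Unshelve. all: by end_near. Qed.

Lemma sheet_openE (U : set T) :
  open U <-> forall x, U x -> nbhs (pr x) (fun z => U (sec x z)).
Proof. by []. Qed.

Lemma sheet_nbhsP (x : T) (A : set T) :
  nbhs x A <-> nbhs (pr x) (fun z => A (sec x z)).
Proof.
split.
  rewrite nbhsE => -[B [oB Bx] BA].
  by apply: filterS ((sheet_openE B).1 oB x Bx) => z /BA.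
move=> nA.
(* [B] is the candidate interior of [A]. It is open because, near [z], the sheet centred at
   [sec y z] coincides with that of [y]. *)
pose B : set T := fun y => nbhs (pr y) (fun z => A (sec y z)).
have BA : B `<=` A by move=> y /nbhs_singleton; rewrite ssec_proj.
rewrite nbhsE; exists B => //; split => //.
apply/sheet_openE => y By.
have : nbhs (pr y) (fun z => nbhs z (fun w => A (sec y w))) by exact: (nbhs_interior By).
have : nbhs (pr y) (ball (pr y) (srad y)) by apply: nbhsx_ballx; exact: srad_gt0.
apply: filterS2 => z bz nz; rewrite /B [pr _](sproj_sec bz).
by apply: filterS2 nz (near_ssec_ssec bz) => w Aw ->.
Qed.

Lemma near_ssec_sproj (x : T) :
  \forall y \near x, ball (pr x) (srad x) (pr y) /\ y = sec x (pr y).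
Proof.
apply/sheet_nbhsP.
have : nbhs (pr x) (ball (pr x) (srad x)) by apply: nbhsx_ballx; exact: srad_gt0.
by apply: filterS => z bz; rewrite [pr (sec x z)](sproj_sec bz).
Qed.

Lemma sproj_continuous : continuous pr.
Proof.
move=> x; apply: continuous_atP => V nV; apply/sheet_nbhsP.
have nb : nbhs (pr x) (ball (pr x) (srad x)).
  by apply: nbhsx_ballx; exact: srad_gt0.
by apply: filterS2 nb nV => z bz; rewrite /preimage /= [pr (sec x z)](sproj_sec bz).
Qed.

Lemma ssec_continuous (x : T) z : ball (pr x) (srad x) z ->
  {for z, continuous (sec x)}.
Proof.
move=> bz; apply: continuous_atP => V /sheet_nbhsP.
rewrite [pr _](sproj_sec bz) => nV.
by apply: filterS2 nV (near_ssec_ssec bz) => w Vw /= <-.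
Qed.

Lemma sproj_local_homeo : local_homeo pr.
Proof.
move=> x; exists [set y | ball (pr x) (srad x) (pr y) /\ y = sec x (pr y)]; split.
- apply/sheet_openE => y [bpy ey].
  apply: filterS2 (near_ball bpy) (near_ssec_ssec bpy) => w bw.
  by rewrite -ey => ->; rewrite /mkset (sproj_sec bw).
- rewrite /mkset ssec_proj; split => //.
  exact: (ballxx (pr x) (srad_gt0 x)).
- by move=> y z; rewrite !inE => -[_ ey] [_ ez] e; rewrite ey ez e.
- move=> V /sheet_openE oV _; rewrite openE => _ [v Vv <-].
  have nb : nbhs (pr v) (ball (pr v) (srad v)).
    by apply: nbhsx_ballx; exact: srad_gt0.
  apply: filterS2 nb (oV v Vv) => z bz Vz; exists (sec v z) => //.
  exact: sproj_sec.
Qed.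

(** Points over distinct projections are separated in the plane. Over the same projection, two
    sheets with a common point would coincide at their common centre, forcing [x = y]. *)
Lemma sheet_hausdorff : hausdorff_space T.
Proof.
rewrite open_hausdorff => x y xy.
have [pxy|/eqP pxy] := pselect (pr x = pr y); last first.
  have : hausdorff_space (R * R)%type by exact: (@norm_hausdorff R).
  rewrite open_hausdorff => /(_ _ _ pxy)[[A B] /= [Ax By] [oA oB AB]].
  exists (pr @^-1` A, pr @^-1` B) => /=; first by rewrite !inE in Ax By *.
  split; [by apply: open_comp => // ? _; exact: sproj_continuous..|].
  by rewrite -preimage_setI (eqP AB) preimage_set0.
have nU v := near_ssec_sproj v.
exists ((interior (fun y => ball (pr x) (srad x) (pr y) /\ y = sec x (pr y))),
        (interior (fun z => ball (pr y) (srad y) (pr z) /\ z = sec y (pr z)))).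
  by rewrite !inE; split; exact: nU.
split; [exact: open_interior..|].
apply/eqP; rewrite -subset0 => z [/= /interior_subset [b1 e1] /interior_subset [b2 e2]].
move/eqP: xy; apply.
rewrite -(ssec_proj x) -(ssec_proj y) -pxy.
apply: (@ssec_compat _ D x y (pr z)) => //.
- by apply: ballxx; exact: srad_gt0.
- by rewrite [sproj x]pxy; apply: ballxx; exact: srad_gt0.
- by rewrite -[LHS]e1 -[RHS]e2.
Qed.

End SheetTheory.

(** * Lengths and allowed paths *)

Section Plane.
Context {R : realType}.
Local Notation C := (R * R)%type.
Implicit Types z w : C.

Definition seg z w (t : R) : C :=
  (z.1 + t * (w.1 - z.1), z.2 + t * (w.2 - z.2)).

Lemma seg0 z w : seg z w 0 = z.
Proof. by case: z => a b; rewrite /seg !mul0r !addr0. Qed.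

Lemma seg1 z w : seg z w 1 = w.
Proof. by case: w => a b; rewrite /seg !mul1r !subrKC. Qed.

Lemma segxx z t : seg z z t = z.
Proof. by case: z => a b; rewrite /seg !subrr !mulr0 !addr0. Qed.

Lemma seg_ball c (r t : R) z w : I01 t -> ball c r z -> ball c r w ->
  ball c r (seg z w t).
Proof. by move=> It [z1 z2] [w1 w2]; split; exact: ball_convR. Qed.

Lemma seg_continuous (T : topologicalType) (f g : T -> C) (h : T -> R) :
  continuous f -> continuous g -> continuous h ->
  continuous (fun x => seg (f x) (g x) (h x)).
Proof.
move=> cf cg ch x.
have c1 (k : T -> C) : continuous k -> {for x, continuous (fun y => (k y).1)}.
  by move=> ck; apply: (@continuous_comp _ _ _ k fst); [exact: ck|exact: cvg_fst].
have c2 (k : T -> C) : continuous k -> {for x, continuous (fun y => (k y).2)}.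
  by move=> ck; apply: (@continuous_comp _ _ _ k snd); [exact: ck|exact: cvg_snd].
apply: (@continuous_pair T R R (fun y => (f y).1 + h y * ((g y).1 - (f y).1))
  (fun y => (f y).2 + h y * ((g y).2 - (f y).2)) x).
- apply: cvgD; first exact: c1.
  by apply: cvgM; [exact: ch|apply: cvgB; exact: c1].
- apply: cvgD; first exact: c2.
  by apply: cvgM; [exact: ch|apply: cvgB; exact: c2].
Qed.

Lemma distC_ge0 z w : 0 <= distC z w.
Proof. exact: sqrtr_ge0. Qed.

Lemma distC_sym z w : distC z w = distC w z.
Proof. by rewrite /distC; congr Num.sqrt; ring. Qed.

Lemma distCxx z : distC z z = 0.
Proof. by rewrite /distC !subrr expr0n /= addr0 sqrtr0. Qed.

Lemma sqrtD_triangle (a b c d : R) :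
  Num.sqrt ((a + c) ^+ 2 + (b + d) ^+ 2) <=
  Num.sqrt (a ^+ 2 + b ^+ 2) + Num.sqrt (c ^+ 2 + d ^+ 2).
Proof.
have p u v : 0 <= u ^+ 2 + v ^+ 2 :> R by rewrite addr_ge0 ?sqr_ge0.
set x := Num.sqrt (a ^+ 2 + _); set y := Num.sqrt (c ^+ 2 + _).
have x0 : 0 <= x by exact: sqrtr_ge0.
have y0 : 0 <= y by exact: sqrtr_ge0.
have x2 : x ^+ 2 = a ^+ 2 + b ^+ 2 by rewrite sqr_sqrtr.
have y2 : y ^+ 2 = c ^+ 2 + d ^+ 2 by rewrite sqr_sqrtr.
have cs : a * c + b * d <= x * y.
  have [h|h] := leP (a * c + b * d) 0; first by rewrite (le_trans h) ?mulr_ge0.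
  rewrite -(@ler_pXn2r _ 2) ?nnegrE ?mulr_ge0 ?(ltW h) //.
  (* Lagrange's identity: [(a * d - b * c) ^+ 2] is the defect in the Cauchy-Schwarz inequality. *)
  rewrite exprMn x2 y2; have := sqr_ge0 (a * d - b * c); nra.
rewrite -(@ler_pXn2r _ 2) ?nnegrE ?addr_ge0 ?sqrtr_ge0 // sqr_sqrtr //.
nra.
Qed.

Lemma distC_triangle z w v : distC z v <= distC z w + distC w v.
Proof.
rewrite /distC.
have -> : z.1 - v.1 = (z.1 - w.1) + (w.1 - v.1) by ring.
have -> : z.2 - v.2 = (z.2 - w.2) + (w.2 - v.2) by ring.
exact: sqrtD_triangle.
Qed.

(** With [norm_le_distC], the passage between the Euclidean distance that measures lengths and the
    balls of the product, which are squares. *)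
Lemma distC_le_norm z w : distC z w <= `|z.1 - w.1| + `|z.2 - w.2|.
Proof.
rewrite /distC -[X in X ^+ 2 + _]addr0 -[X in _ + X ^+ 2]add0r.
by rewrite (le_trans (sqrtD_triangle _ _ _ _)) // !expr0n /= addr0 add0r !sqrtr_sqr.
Qed.

Lemma norm_le_distC z w :
  `|z.1 - w.1| <= distC z w /\ `|z.2 - w.2| <= distC z w.
Proof.
by split; rewrite -sqrtr_sqr ler_sqrt ?addr_ge0 ?sqr_ge0 // ?lerDl ?lerDr sqr_ge0.
Qed.

Lemma distC_seg z w (s t : R) :
  distC (seg z w s) (seg z w t) = `|s - t| * distC z w.
Proof.
rewrite /distC /seg /= -sqrtr_sqr -sqrtrM ?sqr_ge0 //; congr Num.sqrt; ring.
Qed.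

End Plane.

(** * Bounds for the length of a path *)

Section Length.
Context {R : realType}.
Local Notation C := (R * R)%type.
Implicit Types (g : R -> C) (l : R -> R) (s t : R).

(* Yields upper bounds of [path_length] without handling partitions. *)
Definition dominated g l :=
  forall s t, 0 <= s -> s <= t -> t <= 1 -> distC (g s) (g t) <= l t - l s.

Let var_sum_cons g x y p :
  var_sum g [:: x, y & p] = distC (g x) (g y) + var_sum g (y :: p).
Proof. by rewrite /var_sum /= big_ord_recl /= distC_sym. Qed.

Let var_sum1 g x : var_sum g [:: x] = 0.
Proof. by rewrite /var_sum big_ord0. Qed.

Let var_sum0 g : var_sum g [::] = 0.
Proof. by rewrite /var_sum big_ord0. Qed.

Let sorted_le_last (x : R) p : path <=%R x p -> x <= last x p.
Proof.
elim: p x => //= y p IH x /andP[xy /IH]; exact: le_trans.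
Qed.

Let var_sum_le g l (x : R) (p : seq R) : dominated g l -> 0 <= x -> path <=%R x p ->
  last x p <= 1 -> var_sum g (x :: p) <= l (last x p) - l x.
Proof.
move=> dom; elim: p x => [|y p IH] x x0 /=; first by rewrite var_sum1 subrr.
move=> /andP[xy py] l1; rewrite var_sum_cons.
have y1 : y <= 1 by apply: le_trans l1; exact: sorted_le_last.
have h1 := dom x y x0 xy y1.
have h2 := IH y (le_trans x0 xy) py l1.
by have := lerD h1 h2; lra.
Qed.

Let var_sum_ub g l t p : dominated g l -> t <= 1 ->
  Defs.partition0 t p -> var_sum g p <= l t - l 0.
Proof.
move=> dom t1; case: p => [|x p] [srt [/= h0 hl]].
  by rewrite var_sum0 -hl subrr.
by move: srt; rewrite h0 in hl *; rewrite -hl => srt; apply: var_sum_le => //; rewrite hl.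
Qed.

Let partition_ex t : 0 <= t -> Defs.partition0 t [:: 0; t].
Proof. by move=> t0; split; rewrite /= ?t0. Qed.

Lemma path_length_le g l t : dominated g l -> 0 <= l 0 -> I01 t ->
  path_length g t <= l t.
Proof.
move=> dom l0 /andP[t0 t1]; apply: ge_sup.
  by exists (var_sum g [:: 0; t]), [:: 0; t] => //; exact: partition_ex.
move=> _ [p pp <-]; apply: le_trans (var_sum_ub dom t1 pp) _.
by rewrite gerBl.
Qed.

Let lipschitz_dominated g : lipschitz01 g -> exists k, dominated g ( *%R k).
Proof.
move=> [k Lk]; exists k => s t s0 st t1.
rewrite -mulrBr; apply: le_trans (Lk s t _ _) _.
- by apply/andP; split => //; exact: le_trans st t1.
- by apply/andP; split => //; exact: le_trans s0 st.
- by rewrite distrC ger0_norm // subr_ge0.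
Qed.

(** The Lipschitz constant bounds the sums, without which [sup] would be a default value. *)
Lemma path_length_ub g t p : lipschitz01 g -> I01 t -> Defs.partition0 t p ->
  var_sum g p <= path_length g t.
Proof.
move=> /lipschitz_dominated[k dom] /andP[t0 t1] pp; apply: ub_le_sup; last by exists p.
exists (k * t - k * 0) => _ [q qq <-]; exact: (var_sum_ub dom).
Qed.

Let var_sum_rcons g x p t :
  var_sum g (rcons (x :: p) t) = var_sum g (x :: p) + distC (g (last x p)) (g t).
Proof.
elim: p x => [|y p IH] x /=; first by rewrite var_sum_cons !var_sum1 addrC.
by rewrite !var_sum_cons -rcons_cons IH addrA.
Qed.

(** Appending [t] to a partition of [[0, s]] gives one of [[0, t]], with the additional term
    [distC (g s) (g t)]. *)
Lemma path_length_dominated g : lipschitz01 g -> dominated g (path_length g).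
Proof.
move=> Lg s t s0 st t1; rewrite lerBrDr -lerBrDl; apply: ge_sup.
  by exists (var_sum g [:: 0; s]), [:: 0; s] => //; exact: partition_ex.
have It : I01 t by apply/andP; split => //; exact: le_trans st.
move=> _ [p [srt [h0 hl]] <-]; rewrite lerBrDl addrC.
(* By the defaults of [head] and [last], the empty list is also a partition, for [s = 0]. *)
case: p srt h0 hl => [|x p] /= srt h0 hl.
  rewrite var_sum0 add0r -hl; have := path_length_ub Lg It (partition_ex (le_trans s0 st)).
  by rewrite var_sum_cons var_sum1 addr0.
rewrite -hl -var_sum_rcons; apply: path_length_ub => //; split.
  by rewrite /= rcons_path srt hl.
by split; rewrite //= last_rcons.
Qed.

Lemma path_length_ge0 g t : lipschitz01 g -> I01 t -> 0 <= path_length g t.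
Proof.
move=> Lg It; have /andP[t0 t1] := It.
apply: le_trans (path_length_ub Lg It (partition_ex t0)).
by rewrite var_sum_cons var_sum1 addr0 distC_ge0.
Qed.

End Length.

(** * Concatenation of paths *)

Section Concat.
Context {R : realType}.

(** The test is written in the form [h t <= 0] of [continuous_paste]. *)
Definition pcat (X : Type) (c d : R -> X) (t : R) : X :=
  if 2 * t - 1 <= 0 then c (2 * t) else d (2 * t - 1).

Lemma pcat0 (X : Type) (c d : R -> X) : pcat c d 0 = c 0.
Proof. by rewrite /pcat mulr0 sub0r oppr_le0 ler01. Qed.

Lemma pcat1 (X : Type) (c d : R -> X) : pcat c d 1 = d 1.
Proof.
rewrite /pcat ifF; first by congr d; ring.
by apply/negbTE; rewrite -ltNge; lra.
Qed.

Lemma pcat_half (X : Type) (c d : R -> X) s :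
  s <= 1 -> pcat c d (s / 2) = c s.
Proof.
move=> s1; have e : 2 * (s / 2) = s by field.
by rewrite /pcat e ifT //; lra.
Qed.

Lemma pcat_half1 (X : Type) (c d : R -> X) s : c 1 = d 0 ->
  0 <= s -> pcat c d ((1 + s) / 2) = d s.
Proof.
move=> cd s0; have e : 2 * ((1 + s) / 2) = 1 + s by field.
rewrite /pcat e; case: ifP => h; last by congr d; ring.
have -> : s = 0 by lra.
by rewrite addr0.
Qed.

Lemma mulr_continuous (k : R) : continuous (fun t : R => k * t).
Proof. by move=> t; apply: cvgM; [exact: cvg_cst|exact: cvg_id]. Qed.

Lemma two_sub1_continuous : continuous (fun t : R => 2 * t - 1).
Proof. by move=> t; apply: cvgB; [exact: mulr_continuous|exact: cvg_cst]. Qed.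

Lemma pcat_continuous (X : topologicalType) (c d : R -> X) :
  continuous c -> continuous d -> c 1 = d 0 -> continuous (pcat c d).
Proof.
move=> cc cd e; apply: (@continuous_paste R R X (fun t => 2 * t - 1)).
- exact: two_sub1_continuous.
- by move=> t; apply: continuous_comp; [exact: mulr_continuous|exact: cc].
- by move=> t; apply: (@continuous_comp _ _ _ (fun t : R => 2 * t - 1) d);
    [exact: two_sub1_continuous|exact: cd].
- by move=> t h; rewrite h -e; congr c; lra.
Qed.

End Concat.

(** * Allowed paths and their prolongations *)

Section Allowed.
Context {R : realType} (Om : R -> set (R * R)%type).
Local Notation C := (R * R)%type.
Hypothesis dfs : is_dfs Om.

(** As [Om] increases, [S_Om] is stable under increasing the length; translating by [L - L'] carries
    its closure along. *)
Lemma M_Om_down (L L' : R) (w : C) : L' <= L -> M_Om Om (L, w) -> M_Om Om (L', w).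
Proof.
move=> LL; apply: contra_not => cS A nA.
have nA' : nbhs (L', w) [set v : R * C | A (v.1 + (L - L'), v.2)].
  pose sh (v : R * C) := (v.1 + (L - L'), v.2).
  suff csh : {for (L', w), continuous sh}.
    by apply: csh; rewrite /sh /= subrKC.
  apply: continuous_pair; last exact: cvg_snd.
  by apply: cvgD; [exact: cvg_fst|exact: cvg_cst].
have [[l v] [[/= l0 Ov] Av]] := cS _ nA'.
exists (l + (L - L'), v); split => //; split => /=.
  by rewrite addr_ge0 // subr_ge0.
by have [_ [mono _]] := dfs; apply: (mono l) => //; rewrite lerDl subr_ge0.
Qed.

(** Openness bounds [L'] on both sides; [M_Om_down] removes the lower bound, whence the point
    [Num.max L L'] in the proof. *)
Lemma M_Om_open (L : R) (w : C) : M_Om Om (L, w) -> exists2 r : R, 0 < r &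
  forall L' w', L' < L + r -> ball w r w' -> M_Om Om (L', w').
Proof.
move=> M; have : nbhs (L, w) (M_Om Om).
  apply: open_nbhs_nbhs; split => //.
  by rewrite openC; exact: closed_closure.
move=> /nbhs_ballP[r /= r0 rM]; exists r => // L' w' LL bw.
apply: (@M_Om_down (Num.max L L')); first by rewrite le_max lexx orbT.
apply: rM; split => //=; rewrite -ball_normE /= /Num.max.
case: ifP => LL'; last by rewrite subrr normr0.
by rewrite ler0_norm ?subr_le0 ?ltW // opprB ltrBlDl.
Qed.

Lemma M_Om_0 : M_Om Om (0, C0).
Proof.
have [_ [mono [d [d0 Od]]]] := dfs.
move=> cS; have [] := cS [set v : R * C | v.1 < d].
  have : nbhs (0 : R, C0 : C) (fst @^-1` [set l | l < d]) ; last by [].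
  by apply: cvg_fst; exact: lt_nbhsl.
move=> [l v] [[/= l0 Ov] ld].
by have := mono l d l0 (ltW ld) v Ov; rewrite Od.
Qed.

(** By [M_Om_down] the length may be replaced by any [l] that dominates it, so that later paths are
    shown to be allowed by exhibiting such an [l]. *)
Lemma allowedP (g : R -> C) : allowed Om g <->
  [/\ lipschitz01 g, g 0 = C0 & exists l, [/\ dominated g l, 0 <= l 0 &
    forall t, I01 t -> M_Om Om (l t, g t)]].
Proof.
split=> [[Lg [g0 M]]|[Lg g0 [l [dom l0 M]]]].
  split => //; exists (path_length g); split => //.
    exact: path_length_dominated.
  by apply: path_length_ge0 => //; rewrite /I01 /= lexx ler01.
split => //; split => // t It; apply: M_Om_down (M t It).
exact: path_length_le.
Qed.

Lemma allowed_cst : allowed Om (fun _ => C0).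
Proof.
apply/allowedP; split => //.
  by exists 0 => s t _ _; rewrite distCxx mul0r.
exists (fun _ => 0); split => // [s t _ _ _|t _]; last exact: M_Om_0.
by rewrite distCxx subrr.
Qed.

Lemma I01M (s t : R) : I01 s -> I01 t -> I01 (s * t).
Proof.
move=> /andP[s0 s1] /andP[t0 t1]; apply/andP; split; first exact: mulr_ge0.
exact: mulr_ile1.
Qed.

Lemma allowed_restrict (g : R -> C) (t : R) : I01 t -> allowed Om g ->
  allowed Om (fun s => g (t * s)).
Proof.
move=> It /allowedP[[k Lg] g0 [l [dom l0 M]]]; have /andP[t0 t1] := It.
apply/allowedP; split; last (exists (fun s => l (t * s)); split).
- exists (k * t) => s u Is Iu.
  have -> : k * t * `|s - u| = k * `|t * s - t * u|.
    by rewrite -mulrBr normrM (ger0_norm t0) mulrA.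
  by apply: Lg; exact: I01M.
- by rewrite mulr0.
- move=> s u s0 su u1; apply: dom; rewrite ?mulr_ge0 ?ler_wpM2l //.
  by apply: mulr_ile1 => //; exact: le_trans su.
- by rewrite mulr0.
- by move=> s Is; apply: M; exact: I01M.
Qed.

Lemma lipschitz_pcat (c d : R -> C) : lipschitz01 c -> lipschitz01 d ->
  c 1 = d 0 -> lipschitz01 (pcat c d).
Proof.
(* Each half is run at double speed, and a straddling pair is compared through the junction.
   Absolute values are taken because [k] and [k'] may be negative. *)
move=> [k Lc] [k' Ld] cd; exists (2 * `|k| + 2 * `|k'|) => s t.
wlog st : s t / s <= t.
  move=> H Is It; have [st|/ltW st] := leP s t; first exact: H.
  by rewrite distC_sym distrC; exact: H.
move=> /andP[s0 s1] /andP[t0 t1].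
rewrite [`|s - t|]distrC [`|t - s|]ger0_norm ?subr_ge0 //.
have k0 := normr_ge0 k; have k'0 := normr_ge0 k'.
have I0 : I01 (0 : R) by rewrite /I01 /= lexx ler01.
have I1 : I01 (1 : R) by rewrite /I01 /= lexx ler01.
have Lc' u v : 0 <= u -> u <= v -> v <= 1 -> distC (c u) (c v) <= `|k| * (v - u).
  move=> u0 uv v1; apply: le_trans (Lc u v _ _) _; [by apply/andP; split; lra..|].
  by rewrite distrC ger0_norm ?subr_ge0 // ler_wpM2r ?subr_ge0 // ler_norm.
have Ld' u v : 0 <= u -> u <= v -> v <= 1 -> distC (d u) (d v) <= `|k'| * (v - u).
  move=> u0 uv v1; apply: le_trans (Ld u v _ _) _; [by apply/andP; split; lra..|].
  by rewrite distrC ger0_norm ?subr_ge0 // ler_wpM2r ?subr_ge0 // ler_norm.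
have st0 : 0 <= t - s by lra.
have kst := mulr_ge0 k0 st0; have k'st := mulr_ge0 k'0 st0.
rewrite /pcat; case: (lerP (2 * s - 1) 0) => hs; case: (lerP (2 * t - 1) 0) => ht.
- apply: le_trans (Lc' _ _ _ _ _) _; [lra..|]; lra.
- apply: le_trans (distC_triangle _ (c 1) _) _.
  have h1 : distC (c (2 * s)) (c 1) <= `|k| * (1 - 2 * s) by apply: Lc'; lra.
  have h2 : distC (c 1) (d (2 * t - 1)) <= `|k'| * (2 * t - 1 - 0).
    by rewrite cd; apply: Ld'; lra.
  have ht0 : 0 <= 2 * t - 1 by lra.
  have hs0 : 0 <= 1 - 2 * s by lra.
  have h3 := mulr_ge0 k0 ht0; have h4 := mulr_ge0 k'0 hs0.
  apply: le_trans (lerD h1 h2) _; lra.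
- have : t < s by lra.
  by rewrite ltNge st.
- apply: le_trans (Ld' _ _ _ _ _) _; [lra..|]; lra.
Qed.

Lemma lipschitz_seg (z w : C) : lipschitz01 (seg z w).
Proof. by exists (distC z w) => s t _ _; rewrite distC_seg mulrC. Qed.

Lemma allowed_extend (g : R -> C) : allowed Om g -> exists2 r : R, 0 < r &
  forall z, ball (g 1) r z -> allowed Om (pcat g (seg (g 1) z)).
Proof.
move=> /allowedP[Lg g0 [l [dom l0 M]]].
have I1 : I01 (1 : R) by rewrite /I01 /= lexx ler01.
have [r r0 rM] := M_Om_open (M 1 I1).
(* A ball is a square: coordinates smaller than [r / 2] keep the Euclidean length [D] of the segment
   below [r]. *)
exists (r / 2); first by rewrite divr_gt0.
move=> z bz; set D := distC (g 1) z.
have D0 : 0 <= D by exact: distC_ge0.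
have Dr : D < r.
  apply: le_lt_trans (distC_le_norm _ _) _.
  by move: bz => [] /=; rewrite -!ball_normE /= => h1 h2; lra.
apply/allowedP; split.
- by apply: lipschitz_pcat => //; [exact: lipschitz_seg|rewrite seg0].
- by rewrite pcat0.
(* The dominating function goes on from [l 1] at the constant speed of the segment. *)
exists (pcat l (fun u => l 1 + u * D)); split.
- move=> s t s0 st t1; rewrite /pcat.
  case: (lerP (2 * s - 1) 0) => hs; case: (lerP (2 * t - 1) 0) => ht.
  + by apply: dom; lra.
  + apply: le_trans (distC_triangle _ (g 1) _) _.
    have h1 : distC (g (2 * s)) (g 1) <= l 1 - l (2 * s) by apply: dom; lra.
    rewrite -{2}(seg0 (g 1) z) distC_seg sub0r normrN gtr0_norm // -/D; lra.
  + have : t < s by lra.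
  by rewrite ltNge st.
  + rewrite distC_seg -/D distrC ger0_norm ?subr_ge0; last lra.
    by lra.
- by rewrite pcat0.
- move=> t /andP[t0 t1]; rewrite /pcat; case: (lerP (2 * t - 1) 0) => ht.
    by apply: M; apply/andP; split; lra.
  apply: rM; first by nra.
  apply: (@le_ball _ _ _ (r / 2)); first lra.
  apply: seg_ball => //; first by apply/andP; split; lra.
  by apply: ballxx; rewrite divr_gt0.
Qed.

Lemma lipschitz_continuous (g : R -> C) : lipschitz01 g ->
  continuous (fun t => g (clamp t)).
Proof.
move=> [k Lg] t; apply: continuous_atP => V /nbhs_ballP[e /= e0 eV].
pose h (s : R) := `|k| * `|clamp s - clamp t|.
have ch : h @ t --> h t.
  apply: cvgM; first exact: cvg_cst.
  by apply: cvg_norm; apply: cvgB; [exact: clamp_continuous|exact: cvg_cst].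
have ne : nbhs t (h @^-1` [set u | u < e]).
  by apply: ch; apply: lt_nbhsl; rewrite /h subrr normr0 mulr0.
apply: filterS ne => s /= hs; apply: eV.
have hd : distC (g (clamp t)) (g (clamp s)) < e.
  apply: le_lt_trans hs; rewrite distC_sym.
  apply: le_trans (Lg _ _ (clamp_I01 s) (clamp_I01 t)) _.
  by rewrite /h ler_wpM2r // ler_norm.
have [h1 h2] := norm_le_distC (g (clamp t)) (g (clamp s)).
by split; rewrite -ball_normE /=; [exact: le_lt_trans h1 hd|exact: le_lt_trans h2 hd].
Qed.

End Allowed.

(** * The universal endless surface *)

(** The segment from [z] to [w] stays in both balls, and the two sections lift it from the same
    point. This is the source of rigidity for both sheet structures. *)
Lemma sections_agree (R : realType) (X : topologicalType)
    (p : X -> (R * R)%type) (c c' : (R * R)%type) (r r' : R)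
    (s s' : (R * R)%type -> X) :
  hausdorff_space X -> local_homeo p ->
  (forall z, ball c r z -> {for z, continuous s}) ->
  (forall z, ball c' r' z -> {for z, continuous s'}) ->
  (forall z, ball c r z -> p (s z) = z) ->
  (forall z, ball c' r' z -> p (s' z) = z) ->
  forall z w, ball c r z -> ball c' r' z -> ball c r w -> ball c' r' w ->
  s z = s' z -> s w = s' w.
Proof.
move=> hX lp cs cs' ps ps' z w bz bz' bw bw' e.
pose h (t : R) := seg z w (clamp t).
have ch : continuous h.
  apply: (@seg_continuous R R (cst z) (cst w) clamp); try exact: cst_continuous.
  exact: clamp_continuous.
have bh t : ball c r (h t) by apply: seg_ball => //; exact: clamp_I01.
have bh' t : ball c' r' (h t) by apply: seg_ball => //; exact: clamp_I01.
have h1 : h 1 = w by rewrite /h clamp1 seg1.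
rewrite -h1.
apply: (@lift_unique R X p hX lp R (fun t => s (h t)) (fun t => s' (h t)) 0).
- exact: connectedRT.
- by move=> t; apply: (@continuous_comp _ _ _ h s); [exact: ch|exact: cs].
- by move=> t; apply: (@continuous_comp _ _ _ h s'); [exact: ch|exact: cs'].
- by move=> t; rewrite ps // ps'.
- by rewrite /h clamp0 seg0.
Qed.

Section Universal.
Context {R : realType} (Om : R -> set (R * R)%type).
Local Notation C := (R * R)%type.
Hypothesis dfs : is_dfs Om.

Definition lift_of (X : topologicalType) (p : X -> C) (o : X) (g : R -> C)
    (f : R -> X) : Prop :=
  [/\ continuous f, f 0 = o & forall t, p (f t) = g (clamp t)].

Lemma lift_exists (X : topologicalType) (p : X -> C) (o : X) (g : R -> C) :
  endless Om p o -> allowed Om g -> exists f, lift_of p o g f.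
Proof.
move=> [_ _ H] /H [f [cf pf f0]]; exists (fun t => f (clamp t)); split.
- exact: continuous_clamp.
- by rewrite clamp0.
- by move=> t; apply: pf; exact: clamp_I01.
Qed.

Lemma lift_of_unique (X : topologicalType) (p : X -> C) (o : X) (g : R -> C)
    f f' :
  endless Om p o -> lift_of p o g f -> lift_of p o g f' -> forall t, f t = f' t.
Proof.
move=> [[hX _ cp lp] _ _] [cf f0 pf] [cf' f'0 pf'].
apply: (lift_unique hX lp (t0 := 0)) => //; first exact: connectedRT.
  by move=> t; rewrite pf pf'.
by rewrite f0 f'0.
Qed.

(* The coarsest identification of paths compatible with every endless surface:
   the quantification over all surfaces is harmless by impredicativity. *)
Definition same_lift (g g' : R -> C) : Prop :=
  g 1 = g' 1 /\ forall (X : topologicalType) (p : X -> C) (o : X),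
    endless Om p o -> forall f f', lift_of p o g f -> lift_of p o g' f' ->
    f 1 = f' 1.

Lemma same_lift_refl g : same_lift g g.
Proof. by split => // X p o eX f f' lf lf'; exact: lift_of_unique lf lf' 1. Qed.

Lemma same_lift_sym g g' : same_lift g g' -> same_lift g' g.
Proof. by move=> [e H]; split => // X p o eX f f' lf lf'; rewrite (H X p o eX f' f). Qed.

(** A middle path without lifts would only compare end points; being allowed, [g'] has a lift in
    every endless surface. *)
Lemma same_lift_trans g g' g'' : allowed Om g' ->
  same_lift g g' -> same_lift g' g'' -> same_lift g g''.
Proof.
move=> ag' [e H] [e' H']; split=> [|X p o eX f f'' lf lf'']; first by rewrite e.
have [f' lf'] := lift_exists eX ag'.
by rewrite (H X p o eX f f') // (H' X p o eX f' f'').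
Qed.

Lemma pcat_seg_continuous (g : R -> C) : lipschitz01 g ->
  continuous (fun zt : C * R => pcat g (seg (g 1) zt.1) (clamp zt.2)).
Proof.
move=> Lg.
(* A [clamp] is inserted in the argument of [g], whose continuity is known on the unit interval
   only. *)
have -> : (fun zt : C * R => pcat g (seg (g 1) zt.1) (clamp zt.2)) =
  (fun u : C * R => if 2 * clamp u.2 - 1 <= 0 then g (clamp (2 * clamp u.2))
             else seg (g 1) u.1 (2 * clamp u.2 - 1)).
  apply/funext => u; rewrite /pcat; case: ifP => // h; rewrite [clamp (2 * _)]clamp_id //.
  have /andP[h0 _] := clamp_I01 u.2; apply/andP; split; lra.
have c2 : continuous (fun u : C * R => 2 * clamp u.2 - 1).
  move=> u; apply: (@continuous_comp _ _ _ (fun u : C * R => clamp u.2) (fun t : R => 2 * t - 1));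
    last exact: two_sub1_continuous.
  by apply: (@continuous_comp _ _ _ snd clamp); [exact: cvg_snd|exact: clamp_continuous].
apply: (@continuous_paste R (C * R)%type C (fun u => 2 * clamp u.2 - 1)) => //.
- move=> u; apply: (@continuous_comp _ _ _ (fun u : C * R => 2 * clamp u.2) (fun t => g (clamp t)));
    last exact: lipschitz_continuous.
  apply: (@continuous_comp _ _ _ (fun u : C * R => clamp u.2) (fun t : R => 2 * t));
    last exact: mulr_continuous.
  by apply: (@continuous_comp _ _ _ snd clamp); [exact: cvg_snd|exact: clamp_continuous].
- apply: (@seg_continuous R (C * R)%type (cst (g 1)) fst) => //; first exact: cst_continuous.
  by move=> u; exact: cvg_fst.
- move=> u h; rewrite h seg0; congr g; have -> : 2 * clamp u.2 = 1 by lra.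
  exact: clamp1.
Qed.

Lemma lift_pcat_cst (X : topologicalType) (p : X -> C) (o : X) (g : R -> C) f :
  lift_of p o g f ->
  lift_of p o (pcat g (seg (g 1) (g 1))) (fun t => pcat f (cst (f 1)) (clamp t)).
Proof.
move=> [cf f0 pf]; split.
- move=> t; apply: (@continuous_comp _ _ _ clamp (pcat f (cst (f 1)))).
    exact: clamp_continuous.
  by apply: pcat_continuous => //; exact: cst_continuous.
- by rewrite clamp0 pcat0.
- move=> t; rewrite /pcat; case: ifP => h; last by rewrite segxx /= pf clamp1.
  rewrite pf [clamp (2 * _)]clamp_id //.
  by have /andP[h0 _] := clamp_I01 t; apply/andP; split; lra.
Qed.

(** What a sheet of the universal surface becomes in an endless surface: the lifts of the
    prolongations vary continuously with [z], so their ends form a local section of [p]. *)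
Lemma endless_section (X : topologicalType) (p : X -> C) (o : X) (g : R -> C)
    (r : R) :
  endless Om p o -> allowed Om g -> 0 < r ->
  (forall z, ball (g 1) r z -> allowed Om (pcat g (seg (g 1) z))) ->
  exists s : C -> X, [/\ forall z, ball (g 1) r z -> {for z, continuous s},
    forall z, ball (g 1) r z -> p (s z) = z,
    forall z f, ball (g 1) r z -> lift_of p o (pcat g (seg (g 1) z)) f -> f 1 = s z
    & forall f, lift_of p o g f -> f 1 = s (g 1)].
Proof.
move=> eX ag r0 ar; have [Lg _] := ag.
have [[hX _ cp lp] _ _] := eX.
(* Outside the ball the lift is the dummy [cst o]. *)
have /choice[L HL] : forall z, exists f : R -> X, ball (g 1) r z ->
    lift_of p o (pcat g (seg (g 1) z)) f.
  move=> z; have [bz|nb] := pselect (ball (g 1) r z); last by exists (cst o).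
  by have [f lf] := lift_exists eX (ar z bz); exists f.
have ends z f : ball (g 1) r z -> lift_of p o (pcat g (seg (g 1) z)) f -> f 1 = L z 1.
  by move=> bz lf; exact: (lift_of_unique eX lf (HL z bz)).
exists (fun z => L z 1); split => //.
- move=> z bz.
  apply: (@lift_family_continuous R X p hX cp lp C z o L _ (pcat_seg_continuous Lg)).
  have nb : nbhs z (ball (g 1) r).
    by apply: open_nbhs_nbhs; split => //; exact: (@ball_open R C).
  by apply: filterS nb => a /HL[].
- by move=> z bz; have [_ _ ->] := HL z bz; rewrite clamp1 pcat1 seg1.
- move=> f lf; rewrite -(ends _ _ (ballxx _ r0) (lift_pcat_cst lf)).
  by rewrite clamp1 pcat1.
Qed.

Local Notation pt := (subquot (allowed Om) same_lift).
Local Notation ucls := (@cls _ (allowed Om) same_lift _ (allowed_cst dfs)).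
Local Notation urep := (@rep _ (allowed Om) same_lift).

Lemma ucls_eqP g g' : allowed Om g -> allowed Om g' ->
  ucls g = ucls g' <-> same_lift g g'.
Proof.
apply: cls_eqP => [c _|c d _ _|c d e _ vd _].
- exact: same_lift_refl.
- exact: same_lift_sym.
- exact: same_lift_trans.
Qed.

Lemma urep_ucls g : allowed Om g -> same_lift g (urep (ucls g)).
Proof.
by move=> ag; apply/ucls_eqP; rewrite ?cls_rep //; exact: rep_valid.
Qed.

Definition urad (x : pt) : R :=
  projT1 (cid2 (allowed_extend dfs (rep_valid x))).

Lemma urad_gt0 x : 0 < urad x.
Proof. by rewrite /urad; case: cid2. Qed.

Lemma urad_allowed x z : ball (urep x 1) (urad x) z ->
  allowed Om (pcat (urep x) (seg (urep x 1) z)).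
Proof. by rewrite /urad; case: cid2 => /= r _ H; exact: H. Qed.

Definition uproj (x : pt) : C := urep x 1.
Definition usec (x : pt) (z : C) : pt := ucls (pcat (urep x) (seg (urep x 1) z)).

Lemma uproj_ucls g : allowed Om g -> uproj (ucls g) = g 1.
Proof. by move=> ag; have [] := urep_ucls ag. Qed.

Lemma uproj_usec x z : ball (uproj x) (urad x) z -> uproj (usec x z) = z.
Proof.
by move=> bz; rewrite uproj_ucls ?pcat1 ?seg1 //; exact: urad_allowed.
Qed.

Lemma usec_uproj x : usec x (uproj x) = x.
Proof.
have bx : ball (uproj x) (urad x) (uproj x) by apply: ballxx; exact: urad_gt0.
rewrite /usec -[RHS](@cls_rep _ _ same_lift _ (allowed_cst dfs)).
apply/ucls_eqP; [exact: urad_allowed|exact: rep_valid|].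
split; first by rewrite pcat1 seg1.
move=> X p o eX f f' lf lf'.
rewrite (lift_of_unique eX lf (lift_pcat_cst lf')) clamp1.
exact: pcat1.
Qed.

(** In each endless surface both sheets become local sections with the same value at [z], hence at
    [w]. *)
Lemma usec_compat x y z w :
  ball (uproj x) (urad x) z -> ball (uproj y) (urad y) z ->
  ball (uproj x) (urad x) w -> ball (uproj y) (urad y) w ->
  usec x z = usec y z -> usec x w = usec y w.
Proof.
move=> xz yz xw yw /ucls_eqP - /(_ (urad_allowed xz) (urad_allowed yz)) [_ H].
apply/ucls_eqP; [exact: urad_allowed..|].
split; first by rewrite !pcat1 !seg1.
move=> X p o eX f f' lf lf'; have [[hX _ cp lp] _ _] := eX.
have [s [cs ps es _]] := endless_section eX (rep_valid x) (urad_gt0 x) (@urad_allowed x).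
have [s' [cs' ps' es' _]] := endless_section eX (rep_valid y) (urad_gt0 y) (@urad_allowed y).
rewrite (es _ _ xw lf) (es' _ _ yw lf').
apply: (sections_agree hX lp cs cs' ps ps' xz yz xw yw).
have [k lk] := lift_exists eX (urad_allowed xz).
have [k' lk'] := lift_exists eX (urad_allowed yz).
by rewrite -(es _ _ xz lk) -(es' _ _ yz lk'); exact: H lk lk'.
Qed.

Definition universal_sheets : sheets R :=
  Sheets urad_gt0 uproj_usec usec_uproj usec_compat.

Local Notation XOm := (sheet_space universal_sheets).
Local Notation pOm := (@sproj R universal_sheets : XOm -> C).
Definition universal_base : XOm := ucls (fun _ => C0).

(** This curve is the lift of [g] to the universal surface. Near [t] it is [usec x] applied to [g]:
    running along [g] from [t] to [u], or along the segment to [g u], ends at the same point of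
    every endless surface. *)
Lemma restriction_curve_continuous (g : R -> C) : allowed Om g ->
  continuous (fun t => ucls (fun s => g (clamp t * s)) : XOm).
Proof.
move=> ag t; have [Lg _] := ag.
have ar u := allowed_restrict dfs (clamp_I01 u) ag.
set x : XOm := ucls (fun s => g (clamp t * s)).
have px : uproj x = g (clamp t) by rewrite uproj_ucls // mulr1.
have cg := lipschitz_continuous Lg.
have : nbhs t ((fun u => g (clamp u)) @^-1` (ball (uproj x) (urad x))).
  by apply: cg; rewrite px; apply: nbhsx_ballx; exact: urad_gt0.
move=> /nbhs_ballP[e /= e0 eb].
have key : \forall u \near t,
    ucls (fun s => g (clamp u * s)) = usec x (g (clamp u)).
  apply/nbhs_ballP; exists e => // u bu; have bgu := eb _ bu.
  apply/ucls_eqP => //; first exact: urad_allowed.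
  split; first by rewrite mulr1 pcat1 seg1.
  move=> X p o eX f f' lf lf'; have [[hX _ cp lp] _ _] := eX.
  have [s [cs ps es es1]] :=
    endless_section eX (rep_valid x) (urad_gt0 x) (@urad_allowed x).
  rewrite (es _ _ bgu lf').
  have [k lk] := lift_exists eX ag; have [ck k0 pk] := lk.
  (* The lifts of all the restrictions are read off the single lift [k] of [g]. *)
  have lkv v : lift_of p o (fun s => g (clamp v * s)) (fun s => k (clamp v * clamp s)).
    split.
    - move=> a; apply: (@continuous_comp _ _ _ (fun s => clamp v * clamp s) k); last exact: ck.
      by apply: cvgM; [exact: cvg_cst|exact: clamp_continuous].
    - by rewrite clamp0 mulr0.
    - by move=> a; rewrite pk [clamp (_ * _)]clamp_id //; apply: I01M; exact: clamp_I01.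
  rewrite (lift_of_unique eX lf (lkv u)) clamp1 mulr1.
  have kt : k (clamp t) = s (uproj x).
    have [m lm] := lift_exists eX (rep_valid x).
    rewrite -(es1 _ lm); have [_ H] := urep_ucls (ar t).
    by rewrite -(H X p o eX _ _ (lkv t) lm) clamp1 mulr1.
  pose h (a : R) := t + clamp a * (u - t).
  have ch : continuous h.
    move=> a; apply: cvgD; first exact: cvg_cst.
    by apply: cvgM; [exact: clamp_continuous|exact: cvg_cst].
  have bh a : ball (uproj x) (urad x) (g (clamp (h a))).
    by apply: eb; apply: ball_convR => //; [exact: clamp_I01|exact: ballxx].
  have h1 : h 1 = u by rewrite /h clamp1 mul1r subrKC.
  rewrite -{1}h1 -[in RHS]h1.
  apply: (@lift_unique R X p hX lp R (fun a => k (clamp (h a)))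
    (fun a => s (g (clamp (h a)))) 0).
  - exact: connectedRT.
  - move=> a; apply: (@continuous_comp _ _ _ h (fun v => k (clamp v))); first exact: ch.
    by apply: (@continuous_comp _ _ _ clamp k); [exact: clamp_continuous|exact: ck].
  - move=> a; apply: (@continuous_comp _ _ _ (fun a => g (clamp (h a))) s); last exact: cs.
    by apply: (@continuous_comp _ _ _ h (fun v => g (clamp v))); [exact: ch|exact: cg].
  - by move=> a; rewrite ps // pk [clamp (clamp _)]clamp_id //; exact: clamp_I01.
  - by rewrite /h clamp0 mul0r addr0 kt px.
apply: (@continuous_near_eq _ XOm _ _ _ key).
apply: (@continuous_comp _ _ _ (fun u => g (clamp u)) (usec x : C -> XOm)).
  exact: cg.
apply: (@ssec_continuous R universal_sheets x).
by rewrite -px; apply: ballxx; exact: urad_gt0.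
Qed.

Lemma universal_path (x : XOm) : exists c : R -> XOm,
  [/\ continuous c, c 0 = universal_base & c 1 = x].
Proof.
have ax : allowed Om (urep x) by exact: rep_valid.
exists (fun t => ucls (fun s => urep x (clamp t * s))); split.
- exact: restriction_curve_continuous.
- rewrite /universal_base; congr (ucls _); apply/funext => s.
  by rewrite clamp0 mul0r; have [_ []] := ax.
- rewrite -[RHS](@cls_rep _ _ same_lift _ (allowed_cst dfs)); congr (ucls _).
  by apply/funext => s; rewrite clamp1 mul1r.
Qed.

Lemma universal_spread : spread_surface pOm.
Proof.
split.
- exact: sheet_hausdorff.
- exact: (connected_setT_by_paths universal_path).
- exact: sproj_continuous.
- exact: sproj_local_homeo.
Qed.

Lemma universal_is_endless : endless Om pOm universal_base.
Proof.
split; first exact: universal_spread.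
  by rewrite [LHS]uproj_ucls //; exact: allowed_cst.
move=> g ag; exists (fun t => ucls (fun s => g (clamp t * s))); split.
- exact/continuous_subspaceT/restriction_curve_continuous.
- move=> t It; rewrite [LHS]uproj_ucls; last exact: allowed_restrict (clamp_I01 t) ag.
  by rewrite clamp_id // mulr1.
- rewrite /universal_base; congr (ucls _); apply/funext => s.
  by rewrite clamp0 mul0r; have [_ []] := ag.
Qed.

Lemma universal_is_universal : universal_endless Om pOm universal_base.
Proof.
move=> X p o eX; have [[hX cX cp lp] po _] := eX.
have /choice[L HL] : forall x : XOm, exists f : R -> X, lift_of p o (urep x) f.
  by move=> x; apply: (lift_exists eX); exact: rep_valid.
pose q (x : XOm) := L x 1.
(* The definition of [same_lift] makes [q] independent of the representative. *)
have q_cls g f : allowed Om g -> lift_of p o g f -> q (ucls g) = f 1.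
  move=> ag lf; have [_ H] := urep_ucls ag.
  by rewrite (H X p o eX _ _ lf (HL (ucls g))).
have pq x : p (q x) = pOm x by have [_ _ pL] := HL x; rewrite /q pL clamp1.
have cq : continuous q.
  move=> x.
  have [s [cs ps es _]] := endless_section eX (rep_valid x) (urad_gt0 x) (@urad_allowed x).
  (* On the sheet of [x], [q] is a local section of [p] composed with the projection. *)
  have key : \forall y \near x, q y = s (pOm y).
    apply: filterS (near_ssec_sproj x) => y [bpy ey].
    have [k lk] := lift_exists eX (urad_allowed bpy).
    by rewrite -(es _ _ bpy lk) {1}ey; apply: q_cls => //; exact: urad_allowed.
  apply: (continuous_near_eq key).
  apply: (@continuous_comp _ _ _ pOm s); first exact: sproj_continuous.
  by apply: cs; apply: ballxx; exact: urad_gt0.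
exists q; split.
  split => //.
    by apply: (@morphism_local_homeo R _ _ pOm p) => //; exact: sproj_local_homeo.
  rewrite (q_cls _ (cst o)) //; first exact: allowed_cst.
  by split => //; exact: cst_continuous.
(* Two morphisms are lifts of [pOm] through [p] with the same value at the base point. *)
move=> q' [cq' _ pq' q'o].
apply: (lift_unique hX lp (t0 := universal_base)) => //.
- by have [_ cT _ _] := universal_spread.
- by move=> t; rewrite pq pq'.
- rewrite q'o (q_cls _ (cst o)) //; first exact: allowed_cst.
  by split => //; exact: cst_continuous.
Qed.

End Universal.

(** * Homotopies and the universal cover *)

Section Homotopy.
Context {R : realType} {Y : topologicalType}.
Implicit Types (c d e : R -> Y) (a : R -> R).

Definition homotopic c d : Prop := exists H : R * R -> Y,
  [/\ continuous H, forall s, I01 s -> H (s, 0) = c s,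
      forall s, I01 s -> H (s, 1) = d s &
      forall u, I01 u -> H (0, u) = c 0 /\ H (1, u) = c 1].

Lemma I01_0 : I01 (0 : R). Proof. by rewrite /I01 /= lexx ler01. Qed.
Lemma I01_1 : I01 (1 : R). Proof. by rewrite /I01 /= lexx ler01. Qed.

Lemma homotopic_ends c d : homotopic c d -> c 0 = d 0 /\ c 1 = d 1.
Proof.
move=> [H [_ _ Hd He]]; have [e0 e1] := He 1 I01_1.
by rewrite -e0 -e1 !Hd //; [exact: I01_1|exact: I01_0].
Qed.

Lemma homotopic_eq c d : continuous c -> (forall s, I01 s -> c s = d s) ->
  homotopic c d.
Proof.
move=> cc cd; exists (fun v => c v.1); split => // v.
by apply: (@continuous_comp _ _ _ fst c); [exact: cvg_fst|exact: cc].
Qed.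

Lemma homotopic_sym c d : homotopic c d -> homotopic d c.
Proof.
move=> cd; have [e0 e1] := homotopic_ends cd.
have [H [cH Hc Hd He]] := cd.
exists (fun v => H (v.1, 1 - v.2)); split.
- move=> v; apply: (@continuous_comp _ _ _ (fun v : R * R => (v.1, 1 - v.2)) H);
    last exact: cH.
  apply: (@continuous_pair _ R R fst (fun v : R * R => 1 - v.2)); first exact: cvg_fst.
  by apply: cvgB; [exact: cvg_cst|exact: cvg_snd].
- by move=> s Is; rewrite subr0 Hd.
- by move=> s Is; rewrite subrr Hc.
- move=> u /andP[u0 u1]; rewrite /= -e0 -e1; apply: He; apply/andP; split; lra.
Qed.

Lemma homotopic_trans d c e : homotopic c d -> homotopic d e -> homotopic c e.
Proof.
move=> cd de; have [e0 e1] := homotopic_ends cd.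
have [H [cH Hc Hd He]] := cd; have [K [cK Kd Ke Kc]] := de.
(* [H] and [K] match along the seam only for path parameters in [I01], while pasting asks for the
   whole line; hence the [clamp]. *)
pose k1 (v : R * R) := (clamp v.1, 2 * v.2).
pose k2 (v : R * R) := (clamp v.1, 2 * v.2 - 1).
have c1 : continuous (fun v : R * R => clamp v.1).
  move=> v; apply: (@continuous_comp _ _ _ fst clamp); first exact: cvg_fst.
  exact: clamp_continuous.
have ck1 : continuous k1.
  move=> v; apply: (@continuous_pair _ R R (fun v => clamp v.1)); first exact: c1.
  by apply: cvgM; [exact: cvg_cst|exact: cvg_snd].
have ck : continuous (fun v : R * R => 2 * v.2 - 1).
  move=> v; apply: cvgB; last exact: cvg_cst.
  by apply: cvgM; [exact: cvg_cst|exact: cvg_snd].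
have ck2 : continuous k2.
  move=> v; apply: (@continuous_pair _ R R (fun v => clamp v.1)); first exact: c1.
  exact: ck.
exists (fun v => if 2 * v.2 - 1 <= 0 then H (k1 v) else K (k2 v)); split.
- apply: (@continuous_paste R (R * R)%type Y (fun v => 2 * v.2 - 1)) => //.
  + by move=> v; apply: continuous_comp; [exact: ck1|exact: cH].
  + by move=> v; apply: continuous_comp; [exact: ck2|exact: cK].
  + move=> v h; rewrite /k1 /k2 h; have -> : 2 * v.2 = 1 by lra.
    by rewrite Hd ?Kd //; exact: clamp_I01.
- move=> s Is; rewrite /k1 /= mulr0 sub0r oppr_le0 ler01 clamp_id //.
  exact: Hc.
- move=> s Is; rewrite /k2 /= ifF; last by apply/negbTE; rewrite -ltNge; lra.
  by rewrite clamp_id // (_ : 2 * 1 - 1 = 1 :> R) ?Ke //; ring.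
- move=> u /andP[u0 u1]; rewrite /k1 /k2 /= clamp0 clamp1; case: ifP => h.
    by apply: He; apply/andP; split; lra.
  rewrite e0 e1; apply: Kc; apply/andP; split; last lra.
  by have : 0 < 2 * u - 1 by [rewrite ltNge h]; exact: ltW.
Qed.

Lemma homotopic_pcat c c' d d' : homotopic c c' -> homotopic d d' ->
  c 1 = d 0 -> homotopic (pcat c d) (pcat c' d').
Proof.
move=> [H [cH Hc Hc' He]] [K [cK Kd Kd' Ke]] cd.
(* Here the seam is a fixed end of [H] and [K], controlled only for homotopy parameters in [I01]. *)
pose k1 (v : R * R) := (2 * v.1, clamp v.2).
pose k2 (v : R * R) := (2 * v.1 - 1, clamp v.2).
have c1 : continuous (fun v : R * R => clamp v.2).
  move=> v; apply: (@continuous_comp _ _ _ snd clamp); first exact: cvg_snd.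
  exact: clamp_continuous.
have cm : continuous (fun v : R * R => 2 * v.1).
  by move=> v; apply: cvgM; [exact: cvg_cst|exact: cvg_fst].
have ck1 : continuous k1.
  by move=> v; apply: (@continuous_pair _ R R _ (fun v => clamp v.2)); [exact: cm|exact: c1].
have ck : continuous (fun v : R * R => 2 * v.1 - 1).
  by move=> v; apply: cvgB; [exact: cm|exact: cvg_cst].
have ck2 : continuous k2.
  by move=> v; apply: (@continuous_pair _ R R _ (fun v => clamp v.2)); [exact: ck|exact: c1].
exists (fun v => if 2 * v.1 - 1 <= 0 then H (k1 v) else K (k2 v)); split.
- apply: (@continuous_paste R (R * R)%type Y (fun v => 2 * v.1 - 1)) => //.
  + by move=> v; apply: continuous_comp; [exact: ck1|exact: cH].
  + by move=> v; apply: continuous_comp; [exact: ck2|exact: cK].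
  + move=> v h; rewrite /k1 /k2 h; have -> : 2 * v.1 = 1 by lra.
    have [_ ->] := He _ (clamp_I01 v.2); have [-> _] := Ke _ (clamp_I01 v.2).
    by [].
- move=> s /andP[s0 s1]; rewrite /k1 /k2 /pcat /= clamp0; case: (lerP (2 * s - 1) 0) => h.
    by apply: Hc; apply/andP; split; lra.
  by apply: Kd; apply/andP; split; lra.
- move=> s /andP[s0 s1]; rewrite /k1 /k2 /pcat /= clamp1; case: (lerP (2 * s - 1) 0) => h.
    by apply: Hc'; apply/andP; split; lra.
  by apply: Kd'; apply/andP; split; lra.
- move=> u Iu; rewrite pcat0 pcat1 /k1 /k2 /= mulr0 sub0r oppr_le0 ler01 clamp_id //.
  rewrite ifF; last by apply/negbTE; rewrite -ltNge; lra.
  rewrite (_ : 2 * 1 - 1 = 1 :> R); last by ring.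
  by have [-> _] := He u Iu; have [_ ->] := Ke u Iu.
Qed.

(** The straight-line homotopy inside [D], pushed forward by [phi]. With a ball it serves the
    sheets, with the whole plane the reparametrizations. *)
Lemma homotopic_convex (D : set (R * R)%type) (phi : R * R -> Y)
    (f f' : R -> R * R) :
  (forall z w t, I01 t -> D z -> D w -> D (seg z w t)) ->
  (forall z, D z -> {for z, continuous phi}) ->
  continuous f -> continuous f' -> (forall s, D (f s)) -> (forall s, D (f' s)) ->
  f 0 = f' 0 -> f 1 = f' 1 -> homotopic (fun s => phi (f s)) (fun s => phi (f' s)).
Proof.
move=> convD cphi cf cf' Df Df' e0 e1.
pose h (v : R * R) := seg (f v.1) (f' v.1) (clamp v.2).
have ch : continuous h.
  apply: (@seg_continuous R (R * R)%type (fun v => f v.1) (fun v => f' v.1) (fun v => clamp v.2)) => v.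
  - by apply: (@continuous_comp _ _ _ fst f); [exact: cvg_fst|exact: cf].
  - by apply: (@continuous_comp _ _ _ fst f'); [exact: cvg_fst|exact: cf'].
  - by apply: (@continuous_comp _ _ _ snd clamp); [exact: cvg_snd|exact: clamp_continuous].
exists (fun v => phi (h v)); split.
- move=> v; apply: (@continuous_comp _ _ _ h phi); first exact: ch.
  by apply: cphi; apply: convD => //; exact: clamp_I01.
- by move=> s _; rewrite /h /= clamp0 seg0.
- by move=> s _; rewrite /h /= clamp1 seg1.
- by move=> u Iu; rewrite /h /= -e0 -e1 !segxx.
Qed.

Lemma homotopic_reparam c a a' : continuous c -> continuous a -> continuous a' ->
  a 0 = a' 0 -> a 1 = a' 1 -> homotopic (fun s => c (a s)) (fun s => c (a' s)).
Proof.
move=> cc ca ca' e0 e1.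
(* The line is embedded in the plane as its first axis. *)
apply: (@homotopic_convex setT (fun z => c z.1) (fun s => (a s, 0)) (fun s => (a' s, 0))) => //.
- by move=> z _; apply: (@continuous_comp _ _ _ fst c); [exact: cvg_fst|exact: cc].
- by move=> s; apply: (@continuous_pair _ R R a (cst 0)); [exact: ca|exact: cvg_cst].
- by move=> s; apply: (@continuous_pair _ R R a' (cst 0)); [exact: ca'|exact: cvg_cst].
- by rewrite e0.
- by rewrite e1.
Qed.

Lemma fun_pcat (X X' : Type) (f : X -> X') (c d : R -> X) (s : R) :
  f (pcat c d s) = pcat (fun t => f (c t)) (fun t => f (d t)) s.
Proof. by rewrite /pcat; case: ifP. Qed.

Lemma eq_pcat (X : Type) (c c' d d' : R -> X) :
  (forall s, I01 s -> c s = c' s) -> (forall s, I01 s -> d s = d' s) ->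
  forall s, I01 s -> pcat c d s = pcat c' d' s.
Proof.
move=> ec ed s /andP[s0 s1]; rewrite /pcat; case: (lerP (2 * s - 1) 0) => h.
  by apply: ec; apply/andP; split; lra.
by apply: ed; apply/andP; split; lra.
Qed.

Let id_continuous : continuous (fun s : R => s).
Proof. by move=> s; exact: cvg_id. Qed.

Lemma homotopic_pcatA c d e : continuous c -> continuous d -> continuous e ->
  c 1 = d 0 -> d 1 = e 0 ->
  homotopic (pcat (pcat c d) e) (pcat c (pcat d e)).
Proof.
move=> cc cd ce e1 e2; set K := pcat (pcat c d) e.
have cK : continuous K.
  by apply: pcat_continuous; rewrite ?pcat1 //; exact: pcat_continuous.
have cd4 : continuous (fun s : R => s / 4).
  by move=> s; apply: cvgM; [exact: cvg_id|exact: cvg_cst].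
have c1d (k : R) : continuous (fun s : R => (1 + s) / k).
  move=> s; apply: cvgM; last exact: cvg_cst.
  by apply: cvgD; [exact: cvg_cst|exact: cvg_id].
(* The reparametrization [a] sends the intervals cut at 1/2 and 3/4 affinely onto those cut at 1/4
   and 1/2. *)
pose a2 := pcat (fun s : R => (1 + s) / 4) (fun s : R => (1 + s) / 2).
have ca2 : continuous a2 by apply: pcat_continuous => //; field.
pose a := pcat (fun s : R => s / 4) a2.
have ca : continuous a.
  by apply: pcat_continuous => //; rewrite /a2 pcat0; field.
have Ka : homotopic (fun s => K (a s)) (pcat c (pcat d e)).
  apply: homotopic_eq; first by move=> s; apply: continuous_comp; [exact: ca|exact: cK].
  move=> s Is; rewrite /a (fun_pcat K); apply: eq_pcat => // {Is}s Is.
    have /andP[s0 s1] := Is.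
    rewrite (_ : s / 4 = s / 2 / 2); last by field.
    by rewrite /K !pcat_half //; lra.
  rewrite /a2 (fun_pcat K); apply: eq_pcat => // {Is}s Is; have /andP[s0 s1] := Is.
    rewrite (_ : (1 + s) / 4 = (1 + s) / 2 / 2); last by field.
    by rewrite /K pcat_half ?pcat_half1 //; lra.
  by rewrite /K pcat_half1 // pcat1.
apply: homotopic_trans Ka.
apply: (@homotopic_reparam K (fun s => s)) => //.
  by rewrite /a pcat0 mul0r.
by rewrite /a /a2 !pcat1; field.
Qed.

Lemma homotopic_pcat_cst c : continuous c -> homotopic (pcat c (cst (c 1))) c.
Proof.
move=> cc; have -> : pcat c (cst (c 1)) = fun s => c (pcat id (cst 1) s).
  by apply/funext => s; rewrite (fun_pcat c).
apply: (@homotopic_reparam c _ (fun s => s)) => //.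
- by apply: pcat_continuous => //; exact: cst_continuous.
- by rewrite pcat0.
- by rewrite pcat1.
Qed.

Lemma homotopic_cst_pcat c : continuous c -> homotopic (pcat (cst (c 0)) c) c.
Proof.
move=> cc; have -> : pcat (cst (c 0)) c = fun s => c (pcat (cst 0) id s).
  by apply/funext => s; rewrite (fun_pcat c).
apply: (@homotopic_reparam c _ (fun s => s)) => //.
- by apply: pcat_continuous => //; exact: cst_continuous.
- by rewrite pcat0.
- by rewrite pcat1.
Qed.

Lemma rev_continuous c : continuous c -> continuous (fun s : R => c (1 - s)).
Proof.
move=> cc s; apply: (@continuous_comp _ _ _ (fun s : R => 1 - s) c); last exact: cc.
by apply: cvgB; [exact: cvg_cst|exact: cvg_id].
Qed.

Lemma homotopic_rev_pcat c : continuous c ->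
  homotopic (pcat (fun s => c (1 - s)) c) (cst (c 1)).
Proof.
move=> cc.
have -> : pcat (fun s => c (1 - s)) c = fun s => c (pcat (fun s => 1 - s) id s).
  by apply/funext => s; rewrite (fun_pcat c).
apply: (@homotopic_reparam c _ (fun s => 1)) => //.
- apply: pcat_continuous => //; last by rewrite subrr.
  by move=> s; apply: cvgB; [exact: cvg_cst|exact: cvg_id].
- exact: cst_continuous.
- by rewrite pcat0 subr0.
- by rewrite pcat1.
Qed.

(** Cancellation in the fundamental groupoid: put the reverse of [c] in front and reassociate. *)
Lemma homotopic_cancel c d : continuous c -> continuous d -> c 1 = d 0 ->
  homotopic (pcat c d) c -> homotopic d (cst (d 0)).
Proof.
move=> cc cd e h; set ci := fun s => c (1 - s).
have cci : continuous ci by exact: rev_continuous.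
have eci : ci 1 = c 0 by rewrite /ci subrr.
apply: homotopic_trans (homotopic_sym (homotopic_cst_pcat cd)) _.
have h0 : homotopic (pcat (cst (d 0)) d) (pcat (pcat ci c) d).
  apply: homotopic_pcat => //; last exact: homotopic_eq.
  by rewrite -e; apply: homotopic_sym; exact: homotopic_rev_pcat.
apply: homotopic_trans h0 _.
apply: homotopic_trans (homotopic_pcatA _ _ _ _ _) _ => //.
have h1 : homotopic (pcat ci (pcat c d)) (pcat ci c).
  by apply: homotopic_pcat; rewrite ?pcat0 //; exact: homotopic_eq.
by apply: homotopic_trans h1 _; rewrite -e; exact: homotopic_rev_pcat.
Qed.

End Homotopy.

(** * The universal cover, and loops in a universal surface *)

Section Cover.
Context {R : realType} {Y : topologicalType} (p : Y -> (R * R)%type) (b : Y).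
Local Notation C := (R * R)%type.
Hypotheses (hY : hausdorff_space Y) (cp : continuous p) (lp : local_homeo p).

Definition lsec (y : Y) : R * (C -> Y) := projT1 (cid (local_section cp lp y)).
Local Notation lrad y := (lsec y).1.
Local Notation sg y := (lsec y).2.

Lemma lsecP y :
  [/\ 0 < lrad y, sg y (p y) = y, forall z, ball (p y) (lrad y) z -> p (sg y z) = z,
      forall z, ball (p y) (lrad y) z -> {for z, continuous (sg y)} &
      \forall y' \near y, ball (p y) (lrad y) (p y') /\ y' = sg y (p y')].
Proof. by rewrite /lsec; case: cid. Qed.

Let lrad_gt0 y : 0 < lrad y. Proof. by have [] := lsecP y. Qed.
Let sg_center y : sg y (p y) = y. Proof. by have [] := lsecP y. Qed.
Let p_sg y z : ball (p y) (lrad y) z -> p (sg y z) = z.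
Proof. by have [_ _ H _ _] := lsecP y; exact: H. Qed.
Let sg_continuous y z : ball (p y) (lrad y) z -> {for z, continuous (sg y)}.
Proof. by have [_ _ _ H _] := lsecP y; exact: H. Qed.
Let ball_center y : ball (p y) (lrad y) (p y).
Proof. exact: ballxx. Qed.

Definition based (c : R -> Y) : Prop := continuous c /\ c 0 = b.

Lemma based_cst : based (cst b).
Proof. by split => //; exact: cst_continuous. Qed.

Local Notation pt := (subquot based (@homotopic R Y)).
Local Notation ccls := (@cls _ based (@homotopic R Y) _ based_cst).
Local Notation crep := (@rep _ based (@homotopic R Y)).

Lemma ccls_eqP c d : based c -> based d -> ccls c = ccls d <-> homotopic c d.
Proof.
apply: cls_eqP => [e [ce _]|e e' _ _|e e' e'' _ _ _].
- exact: homotopic_eq.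
- exact: homotopic_sym.
- exact: homotopic_trans.
Qed.

Lemma crep_ccls c : based c -> homotopic c (crep (ccls c)).
Proof.
by move=> bc; apply/ccls_eqP; rewrite ?cls_rep //; exact: rep_valid.
Qed.

Definition sheet_seg (y : Y) (z w : C) (t : R) : Y := sg y (seg z w (clamp t)).

Lemma sheet_seg_continuous y z w : ball (p y) (lrad y) z ->
  ball (p y) (lrad y) w -> continuous (sheet_seg y z w).
Proof.
move=> bz bw t; apply: (@continuous_comp _ _ _ (fun t => seg z w (clamp t)) (sg y)).
  apply: (@seg_continuous R R (cst z) (cst w) clamp); try exact: cst_continuous.
  exact: clamp_continuous.
by apply: sg_continuous; apply: seg_ball => //; exact: clamp_I01.
Qed.

Lemma homotopic_sheet y (f f' : R -> C) : continuous f -> continuous f' ->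
  (forall s, ball (p y) (lrad y) (f s)) -> (forall s, ball (p y) (lrad y) (f' s)) ->
  f 0 = f' 0 -> f 1 = f' 1 ->
  homotopic (fun s => sg y (f s)) (fun s => sg y (f' s)).
Proof.
apply: (@homotopic_convex R Y (ball (p y) (lrad y)) (sg y)).
- by move=> z w t It bz bw; exact: seg_ball.
- exact: sg_continuous.
Qed.

Definition extend (c : R -> Y) (z : C) : R -> Y :=
  pcat c (sheet_seg (c 1) (p (c 1)) z).

Lemma extend_based c z : based c -> ball (p (c 1)) (lrad (c 1)) z ->
  based (extend c z).
Proof.
move=> [cc c0] bz; split; last by rewrite /extend pcat0.
apply: pcat_continuous => //; first exact: sheet_seg_continuous.
by rewrite /sheet_seg clamp0 seg0.
Qed.

Lemma extend1 c z : extend c z 1 = sg (c 1) z.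
Proof. by rewrite /extend pcat1 /sheet_seg clamp1 seg1. Qed.

(** The triangle with vertices [p (c 1)], [z] and [w] lies in the ball, and the section carries its
    straight-line homotopy to [Y]. *)
Lemma extend_split c z w : based c ->
  ball (p (c 1)) (lrad (c 1)) z -> ball (p (c 1)) (lrad (c 1)) w ->
  homotopic (extend c w) (pcat (extend c z) (sheet_seg (c 1) z w)).
Proof.
move=> [cc _] bz bw; set y := c 1.
have e1 : c 1 = sheet_seg y (p y) z 0 by rewrite /sheet_seg clamp0 seg0.
have e2 : sheet_seg y (p y) z 1 = sheet_seg y z w 0.
  by rewrite /sheet_seg clamp0 clamp1 seg0 seg1.
apply: homotopic_sym.
apply: homotopic_trans (homotopic_pcatA _ _ _ e1 e2) _ => //;
  try exact: sheet_seg_continuous.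
apply: homotopic_pcat => //; [exact: homotopic_eq| |by rewrite pcat0].
pose f := pcat (fun s => seg (p y) z (clamp s)) (fun s => seg z w (clamp s)).
have -> : pcat (sheet_seg y (p y) z) (sheet_seg y z w) = fun s => sg y (f s).
  by apply/funext => s; rewrite (fun_pcat (sg y)).
have cs (u v : C) : continuous (fun s => seg u v (clamp s)).
  apply: (@seg_continuous R R (cst u) (cst v) clamp); try exact: cst_continuous.
  exact: clamp_continuous.
apply: homotopic_sheet.
- by apply: pcat_continuous => //; rewrite clamp0 clamp1 seg0 seg1.
- exact: cs.
- by move=> s; rewrite /f /pcat; case: ifP => _; apply: seg_ball => //; exact: clamp_I01.
- by move=> s; apply: seg_ball => //; exact: clamp_I01.
- by rewrite /f pcat0 clamp0 !seg0.
- by rewrite /f pcat1 clamp1 !seg1.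
Qed.

Definition cend (x : pt) : Y := crep x 1.
Definition cproj (x : pt) : C := p (cend x).
Definition crad (x : pt) : R := lrad (cend x).
Definition csec (x : pt) (z : C) : pt := ccls (extend (crep x) z).

Lemma cend_ccls c : based c -> cend (ccls c) = c 1.
Proof. by move=> bc; have [_ e1] := homotopic_ends (crep_ccls bc); rewrite /cend e1. Qed.

Lemma crad_gt0 x : 0 < crad x. Proof. exact: lrad_gt0. Qed.

Lemma cend_csec x z : ball (cproj x) (crad x) z -> cend (csec x z) = sg (cend x) z.
Proof.
by move=> bz; rewrite cend_ccls ?extend1 //; apply: extend_based => //; exact: rep_valid.
Qed.

Lemma cproj_csec x z : ball (cproj x) (crad x) z -> cproj (csec x z) = z.
Proof. by move=> bz; rewrite /cproj cend_csec // p_sg. Qed.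

Lemma csec_cproj x : csec x (cproj x) = x.
Proof.
have bx := rep_valid x; have [cx _] := bx.
rewrite /csec -[RHS](@cls_rep _ _ (@homotopic R Y) _ based_cst).
apply/ccls_eqP => //; first by apply: extend_based => //; exact: ball_center.
rewrite /extend; have -> : sheet_seg (crep x 1) (p (crep x 1)) (cproj x) = cst (crep x 1).
  by apply/funext => s; rewrite /sheet_seg segxx sg_center.
exact: homotopic_pcat_cst.
Qed.

(** By [extend_split], reaching [w] means reaching [z] and then following the segment in the sheet;
    the two segments agree because they start at the same point. *)
Lemma csec_compat x y z w :
  ball (cproj x) (crad x) z -> ball (cproj y) (crad y) z ->
  ball (cproj x) (crad x) w -> ball (cproj y) (crad y) w ->
  csec x z = csec y z -> csec x w = csec y w.
Proof.
move=> xz yz xw yw /ccls_eqP H.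
have {}H : homotopic (extend (crep x) z) (extend (crep y) z).
  by apply: H; apply: extend_based => //; exact: rep_valid.
apply/ccls_eqP; [by apply: extend_based => //; exact: rep_valid..|].
have [_] := homotopic_ends H; rewrite !extend1 => sz.
apply: homotopic_trans (extend_split (rep_valid x) xz xw) _.
apply: homotopic_sym; apply: homotopic_trans (extend_split (rep_valid y) yz yw) _.
apply: homotopic_sym; apply: homotopic_pcat => //; last first.
  by rewrite extend1 /sheet_seg clamp0 seg0.
apply: homotopic_eq; first exact: sheet_seg_continuous.
move=> s _; rewrite /sheet_seg.
apply: (sections_agree hY lp (@sg_continuous (crep x 1)) (@sg_continuous (crep y 1))
  (@p_sg _) (@p_sg _) xz yz _ _ sz); apply: seg_ball => //; exact: clamp_I01.
Qed.

Definition cover_sheets : sheets R :=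
  Sheets crad_gt0 cproj_csec csec_cproj csec_compat.

Local Notation Yt := (sheet_space cover_sheets).
Local Notation pYt := (@sproj R cover_sheets : Yt -> C).

Lemma cend_continuous : continuous (cend : Yt -> Y).
Proof.
move=> x.
have key : \forall x' \near x, (cend : Yt -> Y) x' = sg (cend x) (pYt x').
  by apply: filterS (near_ssec_sproj x) => x' [bx' ex']; rewrite {1}ex' [LHS]cend_csec.
apply: (continuous_near_eq key).
apply: (@continuous_comp _ _ _ pYt (sg (cend x))); first exact: sproj_continuous.
by apply: sg_continuous; exact: ball_center.
Qed.

Lemma restrict_based c (t : R) : based c -> based (fun s => c (t * s)).
Proof.
move=> [cc c0]; split; last by rewrite mulr0.
by move=> s; apply: (@continuous_comp _ _ _ (fun s : R => t * s) c);
  [exact: mulr_continuous|exact: cc].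
Qed.

(** Near [t] the path stays in the sheet of [c t], where the piece from [t] to [u] is homotopic to a
    segment; so the curve is locally [csec x] applied to the projection of [c]. *)
Lemma cover_curve_continuous c : based c ->
  continuous (fun t : R => ccls (fun s => c (t * s)) : Yt).
Proof.
move=> bc t; have [cc c0] := bc.
have br u := restrict_based u bc.
set x : Yt := ccls (fun s => c (t * s)).
have ex : cend x = c t by rewrite cend_ccls // mulr1.
have [_ _ _ _ ny] := lsecP (c t).
have : nbhs t (c @^-1` _) := cc t _ ny.
move=> /nbhs_ballP[e /= e0 eb].
have key : \forall u \near t, ccls (fun s => c (u * s)) = csec x (p (c u)).
  apply/nbhs_ballP; exists e => // u bu.
  have [bpu eu] := eb _ bu.
  have bx : based (crep x) by exact: rep_valid.
  have bpx : ball (p (crep x 1)) (lrad (crep x 1)) (p (c u)) by rewrite -/(cend x) ex.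
  apply/ccls_eqP => //; first exact: extend_based.
  pose h (s : R) := t + clamp s * (u - t).
  have ch : continuous h.
    move=> a; apply: cvgD; first exact: cvg_cst.
    by apply: cvgM; [exact: clamp_continuous|exact: cvg_cst].
  have h0 : h 0 = t by rewrite /h clamp0 mul0r addr0.
  have h1 : h 1 = u by rewrite /h clamp1 mul1r subrKC.
  have bh s : ball t e (h s).
    by apply: ball_convR => //; [exact: clamp_I01|exact: ballxx].
  (* For [u < t] the second piece backtracks; [homotopic_reparam] compares only the ends of the
     parameters. *)
  have hc : homotopic (fun s => c (u * s)) (pcat (fun s => c (t * s)) (fun s => c (h s))).
    have -> : pcat (fun s => c (t * s)) (fun s => c (h s)) =
        (fun s => c (pcat (fun s => t * s) h s)).
      by apply/funext => s; rewrite (fun_pcat c).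
    apply: homotopic_reparam => //.
    - exact: mulr_continuous.
    - by apply: pcat_continuous => //; [exact: mulr_continuous|rewrite mulr1 h0].
    - by rewrite pcat0 !mulr0.
    - by rewrite pcat1 mulr1 h1.
  apply: homotopic_trans hc _.
  apply: homotopic_pcat; [exact: crep_ccls| |by rewrite mulr1 h0].
  rewrite -/(cend x) ex /sheet_seg.
  have -> : (fun s => c (h s)) = fun s => sg (c t) (p (c (h s))).
    by apply/funext => s; have [_ ->] := eb _ (bh s); rewrite p_sg //; have [] := eb _ (bh s).
  apply: homotopic_sheet.
  - move=> s; apply: (@continuous_comp _ _ _ (fun s => c (h s)) p); last exact: cp.
    by apply: (@continuous_comp _ _ _ h c); [exact: ch|exact: cc].
  - apply: (@seg_continuous R R (cst (p (c t))) (cst (p (c u))) clamp); try exact: cst_continuous.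
    exact: clamp_continuous.
  - by move=> s; have [] := eb _ (bh s).
  - by move=> s; apply: seg_ball => //; exact: clamp_I01.
  - by rewrite h0 clamp0 seg0.
  - by rewrite h1 clamp1 seg1.
apply: (@continuous_near_eq _ Yt _ _ _ key).
apply: (@continuous_comp _ _ _ (fun u => p (c u)) (csec x : C -> Yt)).
  by apply: (@continuous_comp _ _ _ c p); [exact: cc|exact: cp].
apply: (@ssec_continuous R cover_sheets x).
by rewrite -ex; exact: ball_center.
Qed.

Lemma cover_spread : spread_surface pYt.
Proof.
split.
- exact: sheet_hausdorff.
- apply: (@connected_setT_by_paths R Yt (ccls (cst b))) => x.
  have bx : based (crep x) by exact: rep_valid.
  exists (fun t : R => ccls (fun s => crep x (t * s))); split.
  + exact: cover_curve_continuous.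
  + by congr (ccls _); apply/funext => s; rewrite mul0r; have [_ ->] := bx.
  + rewrite -[RHS](@cls_rep _ _ (@homotopic R Y) _ based_cst); congr (ccls _).
    by apply/funext => s; rewrite mul1r.
- exact: sproj_continuous.
- exact: sproj_local_homeo.
Qed.

(* Up to the parameter [(1 + t) / 2], the path [pcat c f] runs through [c] and
   then through [f] up to the time [t]. *)
Definition cover_lift (c f : R -> Y) (t : R) : Yt :=
  ccls (fun s => pcat c f ((1 + clamp t) / 2 * s)).

Lemma cover_liftP c f : based c -> continuous f -> c 1 = f 0 ->
  [/\ continuous (cover_lift c f), cover_lift c f 0 = ccls c,
      cover_lift c f 1 = ccls (pcat c f) &
      forall t, pYt (cover_lift c f t) = p (f (clamp t))].
Proof.
move=> bc cf cf0; have [cc c0] := bc.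
have bcf : based (pcat c f).
  by split; [exact: pcat_continuous|rewrite pcat0].
split.
- move=> t; apply: (@continuous_comp _ _ _ (fun t => (1 + clamp t) / 2)
    (fun t : R => ccls (fun s => pcat c f (t * s)) : Yt)); last exact: cover_curve_continuous.
  apply: cvgM; last exact: cvg_cst.
  by apply: cvgD; [exact: cvg_cst|exact: clamp_continuous].
- apply/ccls_eqP => //; first exact: restrict_based.
  apply: homotopic_sym; apply: homotopic_eq => // s /andP[s0 s1].
  rewrite clamp0 (_ : _ * s = s / 2); last by field.
  by rewrite pcat_half.
- rewrite /cover_lift clamp1; congr (ccls _); apply/funext => s; congr pcat.
  by field.
- move=> t; rewrite [LHS](congr1 p (cend_ccls _)); last exact: restrict_based.
  by rewrite mulr1 pcat_half1 //; have /andP[] := clamp_I01 t.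
Qed.

(** The cover is built on paths from [b], so its base point over [o] is the class of a path [d] from
    [b] to [o]. An allowed path lifts first to [Y], and the lift is then appended to [d]. *)
Lemma cover_endless (Om : R -> set C) (o : Y) (d : R -> Y) :
  endless Om p o -> based d -> d 1 = o -> endless Om pYt (ccls d).
Proof.
move=> eY bd d1; have [_ po _] := eY; split; first exact: cover_spread.
  by rewrite [LHS](congr1 p (cend_ccls bd)) d1.
move=> g ag; have [f [cf f0 pf]] := lift_exists eY ag.
have [cl l0 _ pl] := cover_liftP bd cf (etrans d1 (esym f0)).
exists (cover_lift d f); split => //; first exact: continuous_subspaceT.
by move=> t It; rewrite pl pf !clamp_id.
Qed.

Lemma universal_loop_null (Om : R -> set C) (o : Y) (d g : R -> Y) :
  endless Om p o -> universal_endless Om p o -> based d -> d 1 = o ->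
  based g -> g 1 = b -> homotopic g (cst b).
Proof.
move=> eY uY bd d1 [cg g0] g1; have [[_ cY _ _] _ _] := eY.
have [q [[cq _ pq qo] _]] := uY _ _ _ (cover_endless eY bd d1).
(* [cend \o q] and the identity are both lifts of [p] through [p] itself, and they agree at [o]. *)
have qK y : cend (q y) = y.
  apply: (lift_unique hY lp (t0 := o) (f := fun y => cend (q y)) (g := fun y => y)) => //.
  - by move=> z; apply: (@continuous_comp _ _ _ q (cend : Yt -> Y));
      [exact: cq|exact: cend_continuous].
  - by move=> z; exact: cvg_id.
  - by rewrite qo cend_ccls.
set c := crep (q b); have bc : based c by exact: rep_valid.
have [cc c0] := bc.
have c1 : c 1 = g 0 by rewrite g0; exact: qK.
have [cl l0 l1 pl] := cover_liftP bc cg c1.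
have clsc : ccls c = q b by exact: cls_rep.
(* Both sides are ends of lifts of the projected loop that start at [q b]. *)
have : cover_lift c g 1 = q (g (clamp 1)).
  apply: (lift_unique (@sheet_hausdorff R cover_sheets)
    (@sproj_local_homeo R cover_sheets) (t0 := 0) (f := cover_lift c g)
    (g := fun t => q (g (clamp t)))) => //.
  - exact: connectedRT.
  - move=> t; apply: (@continuous_comp _ _ _ (fun t => g (clamp t)) q); last exact: cq.
    by apply: (@continuous_comp _ _ _ clamp g); [exact: clamp_continuous|exact: cg].
  - by move=> t; rewrite pl pq.
  - by rewrite l0 clsc clamp0 g0.
rewrite l1 clamp1 g1 -clsc => /ccls_eqP h.
have hcg : homotopic (pcat c g) c.
  by apply: h => //; split; [exact: pcat_continuous|rewrite pcat0].
by rewrite -g0; exact: homotopic_cancel hcg.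
Qed.

End Cover.

(** * Uniqueness up to isomorphism, and simple connectedness *)

Section Morphisms.
Context {R : realType}.
Local Notation C := (R * R)%type.

Lemma endless_morphism_id (X : topologicalType) (p : X -> C) (o : X) :
  endless_morphism p o p o id.
Proof.
split => //; first by move=> x; exact: cvg_id.
move=> x; exists setT; split => //; first exact: openT.
by move=> V oV _; rewrite image_id.
Qed.

Lemma endless_morphism_comp (Om : R -> set C) (X X' X'' : topologicalType)
    (p : X -> C) (o : X) (p' : X' -> C) (o' : X') (p'' : X'' -> C) (o'' : X'')
    (q : X -> X') (r : X' -> X'') :
  endless Om p o -> endless Om p'' o'' ->
  endless_morphism p o p' o' q -> endless_morphism p' o' p'' o'' r ->
  endless_morphism p o p'' o'' (r \o q).
Proof.
move=> [[_ _ _ lp] _ _] [[_ _ cp'' lp''] _ _] [cq _ pq qo] [cr _ pr ro].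
have crq : continuous (r \o q).
  by move=> x; apply: continuous_comp; [exact: cq|exact: cr].
have prq x : p'' ((r \o q) x) = p x by rewrite /= pr pq.
split => //; last by rewrite /= qo ro.
exact: (morphism_local_homeo lp lp'').
Qed.

Lemma universal_endless_iso (Om : R -> set C) (X X' : topologicalType)
    (p : X -> C) (o : X) (p' : X' -> C) (o' : X') :
  endless Om p o -> universal_endless Om p o ->
  endless Om p' o' -> universal_endless Om p' o' -> endless_iso p o p' o'.
Proof.
move=> eX uX eX' uX'.
have [q [mq _]] := uX _ _ _ eX'; have [r [mr _]] := uX' _ _ _ eX.
exists q, r; split => //.
- have [i [_ iP]] := uX _ _ _ eX => x.
  have mrq := endless_morphism_comp eX eX mq mr.
  by rewrite [LHS](iP _ mrq) -(iP _ (endless_morphism_id p o)).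
- have [i [_ iP]] := uX' _ _ _ eX' => x.
  have mqr := endless_morphism_comp eX' eX' mr mq.
  by rewrite [LHS](iP _ mqr) -(iP _ (endless_morphism_id p' o')).
Qed.

End Morphisms.

Lemma universal_simply_connected (R : realType) (Om : R -> set (R * R)%type)
    (Y : topologicalType) (p : Y -> (R * R)%type) (o : Y) :
  endless Om p o -> universal_endless Om p o ->
  (forall y : Y, exists c : R -> Y, [/\ continuous c, c 0 = o & c 1 = y]) ->
  @simply_connected R Y.
Proof.
move=> eY uY pathY; have [[hY cY cp lp] _ _] := eY; split.
  move=> x y; have [c [cc c0 c1]] := pathY x; have [d [cd d0 d1]] := pathY y.
  exists (pcat (fun s => c (1 - s)) d); split.
  - apply: continuous_subspaceT; apply: pcat_continuous => //.
      exact: rev_continuous.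
    by rewrite subrr c0 d0.
  - by rewrite pcat0 subr0.
  - by rewrite pcat1.
move=> g cg g01; have [c [cc c0 c1]] := pathY (g 0).
(* The cover is based at the loop's origin [g 0]; the path required from there to [o] is [c]
   reversed. *)
have [||||H [cH H0 H1 He]] := @universal_loop_null R Y p (g 0) hY cp lp Om o
    (fun s => c (1 - s)) (fun t => g (clamp t)) eY uY.
- by split; [exact: rev_continuous|rewrite subr0].
- by rewrite subrr.
- by split; [exact: continuous_clamp|rewrite clamp0].
- by rewrite clamp1.
exists H; split => //.
- exact: continuous_subspaceT.
- by move=> s Is; rewrite H0 // clamp_id.
- by move=> u Iu; have := He u Iu; rewrite clamp0 clamp1 -g01.
Qed.

Theorem theorem3p2 (R : realType) (Om : R -> set ((R * R)%type)) :
  is_dfs Om ->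
  exists (X0 : topologicalType) (p0 : X0 -> (R * R)%type) (o0 : X0),
    [/\ endless Om p0 o0,
        universal_endless Om p0 o0,
        (forall (X : topologicalType) (p : X -> (R * R)%type) (o : X),
            endless Om p o -> universal_endless Om p o -> endless_iso p0 o0 p o)
      & @simply_connected R X0].
Proof.
move=> dfs; have eX := universal_is_endless dfs.
have uX := universal_is_universal dfs.
exists (sheet_space (universal_sheets dfs)), (@sproj _ _), (universal_base dfs).
split => //.
- by move=> X p o; exact: universal_endless_iso.
- exact: (universal_simply_connected eX uX (@universal_path _ _ dfs)).
Qed.
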